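(* Fix $\alpha\in(0,n]$ and let $f\in D_\alpha(\mathbb B_n)$. If $\mathrm{cap}_\alpha(\mathcal Z(f^* ))>0$, then $f$ is not cyclic in $D_\alpha(\mathbb B_n)$.
   Context: $\mathbb B_n$ and $\mathbb S_n$ are the Euclidean unit ball and unit sphere of $\mathbb C^n$, $\langle z,w\rangle=z_1\overline{w_1}+\dots+z_n\overline{w_n}$. For $\alpha\in\mathbb R$, the Dirichlet-type space $D_\alpha(\mathbb B_n)$ is the Hilbert space of all holomorphic $f(z)=\sum_k a_kz^k$ on $\mathbb B_n$ (sum over multi-indices $k$ of non-negative integers, $|k|=k_1+\dots+k_n$, $k!=k_1!\cdots k_n!$) with $$\|f\|_\alpha^2:=\sum_{k}(n+|k|)^\alpha\frac{(n-1)!\,k!}{(n-1+|k|)!}|a_k|^2<\infty .$$ A function $f\in D_\alpha(\mathbb B_n)$ is cyclic if the closed linear span in $D_\alpha(\mathbb B_n)$ of $\{z_1^{k_1}\cdots z_n^{k_n}f: k_1,\dots,k_n=0,1,\dots\}$ equals $D_\alpha(\mathbb B_n)$. $f^*(\zeta)=\lim_{r\to1^-}f(r\zeta)$ denotes the radial limit of $f$ at $\zeta\in\mathbb S_n$, where it exists, and $\mathcal Z(f^* )\subset\mathbb S_n$ is the set of points of the sphere at which the radial limit exists and equals $0$. Riesz $\alpha$-capacity, $\alpha\in(0,n]$: let $K_\alpha(t)=t^{\alpha-n}$ if $\alpha\in(0,n)$ and $K_n(t)=\log(e/t)$ for $t>0$, with $K_\alpha(0):=\lim_{t\to0^+}K_\alpha(t)=\infty$.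 For a Borel probability measure $\mu$ supported on a Borel set $E\subset\mathbb S_n$, its Riesz $\alpha$-energy is $$I_\alpha[\mu]=\int_{\mathbb S_n}\int_{\mathbb S_n}K_\alpha(|1-\langle\zeta,\eta\rangle|)\,d\mu(\zeta)\,d\mu(\eta),$$ and $\mathrm{cap}_\alpha(E)=\big(\inf\{I_\alpha[\mu]:\mu\in\mathcal P(E)\}\big)^{-1}$, where $\mathcal P(E)$ is the set of Borel probability measures supported on $E$ (with $\inf\emptyset=\infty$ and $1/\infty=0$). *)

(* Defs.v *)
From HB Require Import structures.
From mathcomp Require Import all_boot all_order all_algebra finmap complex.
From mathcomp Require Import all_classical all_reals all_analysis.

Set Implicit Arguments.
Unset Strict Implicit.
Unset Printing Implicit Defensive.

Import Order.TTheory GRing.Theory Num.Theory.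
Import ComplexField.Normc.
Import numFieldNormedType.Exports.

Local Open Scope classical_set_scope.
Local Open Scope ring_scope.

(* R[i] gets the topology and norm that every numFieldType K carries as K^o. *)
HB.instance Definition _ (R : rcfType) := NormedModule.copy R[i] (R[i])^o.

(* The filter of finite subsets of I ordered by inclusion: convergence along it
   is unordered summability. *)
Definition totally {I : choiceType} : set_system {fset I} :=
  filter_from setT (fun A => [set B : {fset I} | (A `<=` B)%fset]).

Definition sums_to {R : realType} {I : choiceType} (u : I -> R[i]) (l : R[i]) :=
  (fun J : {fset I} => \sum_(i <- J) u i) @ totally --> l.

Section Euclidean.
Context {R : realType} {n : nat}.
Implicit Types z w : 'rV[R[i]]_n.

Definition inner z w : R[i] := \sum_(j < n) z 0 j * ((w 0 j)^*)%C.

Definition sqnorm z : R := \sum_(j < n) normc (z 0 j) ^+ 2.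

Definition ball1 : set 'rV[R[i]]_n := [set z | sqnorm z < 1].

Definition sphere1 : set 'rV[R[i]]_n := [set z | sqnorm z = 1].

End Euclidean.

Arguments ball1 : clear implicits.
Arguments sphere1 : clear implicits.

Definition multiindex (n : nat) := {ffun 'I_n -> nat}.

Definition mdeg n (k : multiindex n) : nat := (\sum_j k j)%N.

Definition mfact n (k : multiindex n) : nat := (\prod_j (k j)`!)%N.

Definition monomial {R : realType} n (k : multiindex n) (z : 'rV[R[i]]_n) :=
  \prod_(j < n) z 0 j ^+ k j.

(* Functions on the ball are total functions on C^n whose values off the ball
   are irrelevant. *)
Section Dirichlet.
Context {R : realType} {n : nat}.
Implicit Types (f g p : 'rV[R[i]]_n -> R[i]) (a : multiindex n -> R[i]).

(* Differentiability is over the scalar field C, i.e. the differential is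
   C-linear. *)
Definition holomorphic f :=
  forall z, ball1 R n z -> differentiable f z.

Definition has_expansion f a :=
  forall z, ball1 R n z -> sums_to (fun k => a k * monomial k z) (f z).

(* The coefficients a_k of f(z) = sum_k a_k z^k, which are unique when such an
   expansion exists; otherwise all of them are 0 by convention. *)
Definition taylor f : multiindex n -> R[i] := xget (fun=> 0) (has_expansion f).

Definition weight (alpha : R) (k : multiindex n) : R :=
  ((n + mdeg k)%:R `^ alpha) *
    (((n.-1)`! * mfact k)%:R / ((n.-1 + mdeg k)`!)%:R).

Definition dsqnorm (alpha : R) f : \bar R :=
  \esum_(k in [set: multiindex n])
     (weight alpha k * normc (taylor f k) ^+ 2)%:E.

Definition dirichlet (alpha : R) : set ('rV[R[i]]_n -> R[i]) :=
  [set f | [/\ holomorphic f, exists a, has_expansion f a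
             & (dsqnorm alpha f < +oo)%E]].

Definition monomial_multiples f : set ('rV[R[i]]_n -> R[i]) :=
  [set g | exists k, g = (fun z => monomial k z * f z)].

Definition lin_span (S : set ('rV[R[i]]_n -> R[i])) :
    set ('rV[R[i]]_n -> R[i]) :=
  [set p | exists (m : nat) (c : 'I_m -> R[i])
             (g : 'I_m -> 'rV[R[i]]_n -> R[i]),
           (forall i, S (g i)) /\ p = (fun z => \sum_(i < m) c i * g i z)].

Definition dclosure (alpha : R) (S : set ('rV[R[i]]_n -> R[i])) :
    set ('rV[R[i]]_n -> R[i]) :=
  [set g | dirichlet alpha g /\ forall eps : R, 0 < eps ->
     exists2 p, S p & (dsqnorm alpha (fun z => (g z - p z)%R) < (eps ^+ 2)%:E)%E].

Definition cyclic (alpha : R) f :=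
  dclosure alpha (lin_span (monomial_multiples f)) = dirichlet alpha.

Definition has_radial_limit f (zeta : 'rV[R[i]]_n) (l : R[i]) :=
  f (r%:C%C *: zeta) @[r --> (1 : R)^'-] --> l.

Definition boundary_zeros f : set 'rV[R[i]]_n :=
  [set zeta | sphere1 R n zeta /\ has_radial_limit f zeta 0].

End Dirichlet.

(* C^n with its Borel sigma-algebra. *)
Definition borelCn (R : realType) (n : nat) :=
  g_sigma_algebraType (@open 'rV[R[i]]_n).

HB.instance Definition _ (R : realType) (n : nat) :=
  Measurable.on (borelCn R n).

Definition riesz_kernel {R : realType} (n : nat) (alpha t : R) : \bar R :=
  if t == 0 then +oo%E
  else if alpha == n%:R then (ln (expR 1 / t))%:E
  else (t `^ (alpha - n%:R))%:E.

Section Capacity.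
Context {R : realType} {n : nat}.

Definition energy (alpha : R) (mu : probability (borelCn R n) R) : \bar R :=
  (\int[mu]_(zeta in sphere1 R n) \int[mu]_(eta in sphere1 R n)
     riesz_kernel n alpha (normc (1 - inner zeta eta)%R))%E.

(* For Borel E this says mu E = 1. *)
Definition supported_on (mu : probability (borelCn R n) R)
    (E : set (borelCn R n)) :=
  mu.-negligible (~` E).

(* The extended inverse satisfies +oo^-1 = 0, so no measure gives capacity 0. *)
Definition riesz_cap (alpha : R) (E : set 'rV[R[i]]_n) : \bar R :=
  ((ereal_inf [set energy alpha mu | mu in [set mu | supported_on mu E]])^-1)%E.

End Capacity.

(* Main.v *)
Require Import Defs.
From mathcomp Require Import all_boot all_order all_algebra finmap complex.
From mathcomp Require Import all_classical all_reals all_analysis.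
From mathcomp Require Import measurable_realfun.
From mathcomp Require Import ring lra.

Set Implicit Arguments.
Unset Strict Implicit.
Unset Printing Implicit Defensive.

Import Order.TTheory GRing.Theory Num.Theory.
Import ComplexField.Normc.
Import numFieldNormedType.Exports.

Local Open Scope classical_set_scope.
Local Open Scope ring_scope.

(** A set of positive capacity carries a probability measure [mu] of finite
    energy.  The heart of the proof is that finite energy makes g |-> g(r .)
    continuous from D_alpha to L^1(mu), with a constant that does not depend
    on r < 1 ([radial_embedding]).  Suppose that [f] is cyclic and that [mu]
    lives on the radial zeros of [f].  Some p = q f, with q a polynomial, is
    then as close to 1 in D_alpha as desired, while p(r z) tends to 0 as r
    tends to 1 for mu-almost every z.  Fatou's lemma applied to |1 - p(r z)|
    gives 1 <= sqrt B * |1 - p|_alpha, which is absurd once 1 - p is small.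

    The embedding is proved for polynomials ([dirichlet_embedding]) and passes
    to the limit by Fatou.  For p = sum_k a_k z^k put c = conj p / |p|; then
    the integral of |p| is sum_k a_k H_k, where H_k is the integral of c z^k,
    and by Cauchy-Schwarz it remains to bound sum_k |H_k|^2 / w_k by the
    energy.  The reproducing kernel of D_alpha would do it, but it has no
    closed form; the polynomial
      Q(u) = sum_(j < N) 2^(- alpha j) (1 + u + ... + u^(2^j - 1))^n
    replaces it.  Its coefficients are nonnegative and, up to a constant, at
    least those of the reproducing kernel in all degrees below N - 1
    ([coef_dyadic_poly_ge]), which is the only comparison needed.  Each
    geometric sum has modulus at most min (2^j) (2 / |1 - u|), so that
    |Q(u)| <= C K_alpha(|1 - u|) with C independent of N, for alpha < n and
    for alpha = n alike ([dyadic_kernel_le]).  Expanding <z,w>^m over words of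
    length m, each multi-index k occurring m!/k! times, turns
    sum_m Q_m sum_words |H|^2 into the double integral of
    c(z) conj(c(w)) Q(<z,w>) ([sum_sqr_cint_le]).

    The norm of a function is computed from coefficients picked among its
    power series expansions, so that even 1 belongs to D_alpha only because
    expansions are unique ([expansion_unique]). *)

Local Notation Re := complex.Re.
Local Notation Im := complex.Im.

(** * Size of the dyadic kernel *)
Section DyadicKernel.
Context {R : realType}.
Implicit Types (q x t alpha : R) (n N : nat).

(** With q = 2^(- alpha) this bounds the dyadic kernel at every point u <> 1
    of the closed unit disc with 2 / |1 - u| = x. *)
Definition dyadic_sum n q N x : R :=
  \sum_(j < N) q ^+ j * Num.min (2 ^+ j) x ^+ n.

(** Self-similarity: all the terms but the first form a rescaled copy of the
    sum at x / 2.  Every bound below is an induction on N through this step. *)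
Lemma dyadic_sumS n q N x :
  dyadic_sum n q N.+1 x =
  Num.min 1 x ^+ n + q * 2 ^+ n * dyadic_sum n q N (x / 2).
Proof.
rewrite /dyadic_sum big_ord_recl /= expr0 expr0 mul1r mulr_sumr; congr (_ + _).
apply: eq_bigr => j _; rewrite /bump /= add1n.
have -> : Num.min (2 ^+ j.+1) x = 2 * Num.min (2 ^+ j) (x / 2) :> R.
  by rewrite minr_pMr // exprS mulrCA divff ?mulr1.
by rewrite exprMn exprS; ring.
Qed.

(** The geometric series obtained by replacing each minimum with x; this is of
    the right order only when x is bounded. *)
Lemma dyadic_sum_le_pow n q N x : 0 < q < 1 -> 0 <= x ->
  dyadic_sum n q N x <= x ^+ n / (1 - q).
Proof.
move=> /andP[q0 q1]; have q1' : 1 - q > 0 by rewrite subr_gt0.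
elim: N x => [|N IH] x x0.
  by rewrite /dyadic_sum big_ord0 divr_ge0 ?exprn_ge0 // ltW.
rewrite dyadic_sumS.
have h1 : Num.min 1 x ^+ n <= x ^+ n.
  by rewrite lerXn2r ?nnegrE ?le_min ?x0 ?ler01 // ge_min lexx orbT.
have h2 : q * 2 ^+ n * dyadic_sum n q N (x / 2) <= q * x ^+ n / (1 - q).
  have -> : q * x ^+ n / (1 - q) = q * 2 ^+ n * ((x / 2) ^+ n / (1 - q)).
    rewrite expr_div_n; field; by rewrite expf_neq0 //= gt_eqF.
  by rewrite ler_pM2l ?mulr_gt0 ?exprn_gt0 // IH // divr_ge0.
apply: le_trans (lerD h1 h2) _; rewrite le_eqVlt; apply/orP; left.
by apply/eqP; field; rewrite gt_eqF.
Qed.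

Lemma exprn_min1_le1 n x : 0 <= x -> Num.min 1 x ^+ n <= 1.
Proof.
by move=> x0; rewrite exprn_ile1 ?le_min ?x0 ?ler01 // ge_min lexx.
Qed.

(** Halving x repeatedly ends in [1/2, 1), where the geometric bound is good
    enough; so a gauge h dominates all the sums as soon as it dominates there
    and is at least as large as what one halving step adds. *)
Lemma dyadic_sum_le n q (h : R -> R) : 0 < q < 1 ->
    (forall x, 2^-1 <= x -> 0 <= h x) ->
    (forall x, 2^-1 <= x < 1 -> (1 - q)^-1 <= h x) ->
    (forall x, 1 <= x -> 1 + q * 2 ^+ n * h (x / 2) <= h x) ->
  forall N x, 2^-1 <= x -> dyadic_sum n q N x <= h x.
Proof.
move=> q01 h0 hs hr; have /andP[q0 q1] := q01.
elim=> [|N IH] x x2; first by rewrite /dyadic_sum big_ord0 h0.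
have x0 : 0 <= x by apply: le_trans x2; rewrite invr_ge0.
have [x1|x1] := ltP x 1; last first.
  rewrite dyadic_sumS; apply: le_trans (hr _ x1).
  rewrite lerD ?exprn_min1_le1 // ler_pM2l ?mulr_gt0 ?exprn_gt0 // IH //.
  by rewrite ler_pMl ?invr_gt0.
apply: le_trans (hs _ _); last by rewrite x2.
apply: (le_trans (dyadic_sum_le_pow n N.+1 q01 x0)).
by rewrite ler_piMl ?invr_ge0 ?subr_ge0 ?(ltW q1) // exprn_ile1 // ltW.
Qed.

Lemma powR2_gt1 (y : R) : 0 < y -> 1 < 2 `^ y.
Proof.
move=> y0; apply: (@le_lt_trans _ _ (1 `^ y)); first by rewrite powR1.
by apply: gt0_ltr_powR; rewrite ?nnegrE ?ltr1n.
Qed.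

Lemma powR2N_lt1 (y : R) : 0 < y -> 0 < 2 `^ (- y) < 1.
Proof.
by move=> y0; rewrite powR_gt0 //= powRN invf_lt1 ?powR2_gt1 // powR_gt0.
Qed.

Lemma powR2N_expr n alpha : 2 `^ (- alpha) * 2 ^+ n = 2 `^ (n%:R - alpha).
Proof. by rewrite -powR_mulrn // -powRD ?pnatr_eq0 ?implybT // addrC. Qed.

(** The gauge is B x^s - B' with s = n - alpha: the constant subtracted absorbs
    the term 1 of each halving step, because 1 - 2^s B' = - B'. *)
Lemma dyadic_sum_le_powR n alpha : 0 < alpha < n%:R ->
  exists2 C : R, 0 < C & forall N x, 1 <= x ->
    dyadic_sum n (2 `^ (- alpha)) N x <= C * x `^ (n%:R - alpha).
Proof.
move=> /andP[a0 an]; have := powR2N_expr n alpha.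
have := powR2N_lt1 a0; set q := 2 `^ _; set s := n%:R - alpha.
move=> q01 qs; have /andP[q0 q1] := q01.
have s0 : 0 < s by rewrite subr_gt0.
pose A := (1 - q)^-1; pose B' := (2 `^ s - 1)^-1; pose B := 2 `^ s * (A + B').
have A0 : 0 < A by rewrite invr_gt0 subr_gt0.
have B'0 : 0 < B' by rewrite invr_gt0 subr_gt0 powR2_gt1.
have T0 : 0 < 2 `^ s :> R by rewrite powR_gt0.
have B0 : 0 < B by rewrite mulr_gt0 ?addr_gt0.
have B'E : 1 - 2 `^ s * B' = - B'.
  by rewrite /B'; field; rewrite gt_eqF // subr_gt0 powR2_gt1.
exists B => // N x x1.
apply: (@le_trans _ _ (B * x `^ s - B')); last by rewrite gerBl ltW.
have hA y : 2^-1 <= y -> A <= B * y `^ s - B'.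
  move=> y2; rewrite lerBrDr /B mulrAC; apply: ler_peMl.
    by rewrite addr_ge0 ?ltW.
  rewrite -powRM ?ler0n ?(le_trans _ y2) ?invr_ge0 //.
  apply: (@le_trans _ _ (1 `^ s)); first by rewrite powR1.
  apply: ge0_ler_powR; rewrite ?nnegrE ?(ltW s0) //.
    by rewrite mulr_ge0 // (le_trans _ y2) ?invr_ge0.
  by rewrite -ler_pdivrMl // mulr1.
apply: (dyadic_sum_le (h := fun x => B * x `^ s - B')) => //.
- by move=> y /hA; apply: le_trans; apply: ltW.
- by move=> y /andP[/hA].
- move=> y y1 /=; have y0 : 0 <= y by apply: le_trans y1.
  have yE : 2 `^ s * (y / 2) `^ s = y `^ s.
    by rewrite -powRM ?divr_ge0 // mulrC divfK.
  rewrite qs -yE mulrBr addrCA B'E (mulrCA (2 `^ s)).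
  by [].
- by apply: le_trans x1; rewrite invf_le1 ?ler1n.
Qed.

(** In the critical case 2^n q = 1 each halving step adds exactly 1, whence a
    gauge growing like the binary logarithm of x. *)
Lemma dyadic_sum_le_ln n : (0 < n)%N ->
  exists2 C : R, 0 < C & forall N x, 1 <= x ->
    dyadic_sum n (2 `^ (- n%:R)) N x <= C * ln (expR 1 * x / 2).
Proof.
move=> n0; have := powR2N_expr n n%:R.
have := @powR2N_lt1 n%:R; rewrite ltr0n n0 => /(_ isT).
set q := 2 `^ _; rewrite subrr powRr0 => q01 qs.
have /andP[q0 q1] := q01.
pose A := (1 - q)^-1.
have A0 : 0 < A by rewrite invr_gt0 subr_gt0.
have l2 : 0 < ln 2 :> R by rewrite ln_gt0 // ltr1n.
have l21 : ln 2 < 1 :> R.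
  rewrite -ltr_expR lnK ?posrE //; have := @expR_gt1Dx R 1 (oner_neq0 _).
  exact: le_lt_trans.
pose h (x : R) := A + 1 + ln x / ln 2.
have hA y : 2^-1 <= y -> A <= h y.
  move=> y2; rewrite /h -addrA lerDl -[X in X + _](divff (lt0r_neq0 l2)).
  rewrite -mulrDl divr_ge0 ?(ltW l2) //.
  have y0 : 0 < y by apply: lt_le_trans y2; rewrite invr_gt0.
  by rewrite -lnM ?posrE // ln_ge0 // mulrC -ler_pdivrMr // mul1r.
exists ((A + 1) / (1 - ln 2) + (ln 2)^-1).
  by rewrite addr_gt0 ?invr_gt0 // divr_gt0 ?subr_gt0 // addr_gt0.
move=> N x x1; have x0 : 0 < x by apply: lt_le_trans x1.
apply: (@le_trans _ _ (h x)).
  apply: (dyadic_sum_le (h := h)) => //.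
  - by move=> y /hA; apply: le_trans; apply: ltW.
  - by move=> y /andP[/hA].
  - move=> y y1; have y0 : 0 < y by apply: lt_le_trans y1.
    rewrite qs mul1r /h ln_div ?posrE // mulrBl divff ?gt_eqF //.
    by rewrite le_eqVlt; apply/orP; left; apply/eqP; ring.
  - by apply: le_trans x1; rewrite invf_le1 ?ler1n.
rewrite ln_div ?posrE ?mulr_gt0 ?expR_gt0 // lnM ?posrE ?expR_gt0 // expRK /h.
have lx : 0 <= ln x by rewrite ln_ge0.
rewrite mulrDl lerD //.
  by rewrite mulrAC ler_pdivlMr ?subr_gt0 // ler_pM2l ?addr_gt0 // addrAC lerDl.
by rewrite mulrC ler_pM2l ?invr_gt0 // addrAC lerDr subr_ge0 ltW.
Qed.

Lemma dyadic_sum_le_riesz n alpha : 0 < alpha <= n%:R ->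
  exists2 C : R, 0 < C & forall N t, 0 <= t <= 2 ->
    ((dyadic_sum n (2 `^ (- alpha)) N (2 / t))%:E <=
     C%:E * riesz_kernel n alpha t)%E.
Proof.
move=> /andP[a0]; rewrite le_eqVlt => /orP[/eqP an|an].
  have n0 : (0 < n)%N by move: a0; rewrite an ltr0n.
  have [C C0 H] := dyadic_sum_le_ln n0; exists C => // N t /andP[t0 t2].
  rewrite /riesz_kernel an eqxx; case: eqVneq => [_|tn0]; first by rewrite gt0_muley ?lte_fin ?leey.
  have {}t0 : 0 < t by rewrite lt_def tn0.
  rewrite lee_fin; apply: le_trans (H _ _ _) _; first by rewrite ler_pdivlMr ?mul1r.
  by have -> : expR 1 * (2 / t) / 2 = expR 1 / t by field.
have [C C0 H] := @dyadic_sum_le_powR n alpha (introT andP (conj a0 an)).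
have s0 : 0 < n%:R - alpha by rewrite subr_gt0.
exists (C * 2 `^ (n%:R - alpha)); first by rewrite mulr_gt0 ?powR_gt0.
move=> N t /andP[t0 t2].
rewrite /riesz_kernel; case: eqVneq => [_|tn0].
  by rewrite gt0_muley ?leey // lte_fin mulr_gt0 ?powR_gt0.
have {}t0 : 0 < t by rewrite lt_def tn0.
rewrite (lt_eqF an) lee_fin; apply: le_trans (H _ _ _) _.
  by rewrite ler_pdivlMr ?mul1r.
rewrite powRM ?invr_ge0 ?(ltW t0) // mulrA -{1}(powR_inv1 (ltW t0)) -powRrM.
by rewrite mulN1r opprB.
Qed.

End DyadicKernel.

(** * The dyadic kernel as a polynomial *)
Section GeometricPolynomials.
Context {R : realType}.
Implicit Types (u : R[i]) (alpha : R) (n N L m : nat).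

Lemma normc_ge0 (u : R[i]) : 0 <= normc u.
Proof. by case: u => a b; exact: sqrtr_ge0. Qed.

Lemma normcX (u : R[i]) k : normc (u ^+ k) = normc u ^+ k.
Proof. by elim: k => [|k IH]; rewrite ?expr0 ?normc1 // !exprS normcM IH. Qed.

Lemma normcD_le (u v : R[i]) : normc (u + v) <= normc u + normc v.
Proof. exact: le_normcD. Qed.

Lemma normc_opp (u : R[i]) : normc (- u) = normc u.
Proof. exact: normcN. Qed.

Lemma normc_sum_le (I : Type) (r : seq I) (P : pred I) (F : I -> R[i]) :
  normc (\sum_(i <- r | P i) F i) <= \sum_(i <- r | P i) normc (F i).
Proof.
elim/big_rec2: _ => [|i x y _ IH]; first by rewrite normc0.
by apply: le_trans (normcD_le _ _) _; rewrite lerD2l.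
Qed.

Lemma normc_real (x : R) : normc x%:C%C = `|x|.
Proof. by rewrite /normc /= expr0n /= addr0 sqrtr_sqr. Qed.

Lemma normc_geom_le u L : normc u <= 1 -> u != 1 ->
  normc (\sum_(i < L) u ^+ i) <= Num.min L%:R (2 / normc (1 - u)).
Proof.
move=> u1 un1; have d0 : 0 < normc (1 - u).
  rewrite lt_def normc_ge0 andbT; apply: contra un1 => /eqP /eq0_normc.
  by move/eqP; rewrite subr_eq0 eq_sym.
have pow k : normc (u ^+ k) <= 1 by rewrite normcX exprn_ile1 ?normc_ge0.
rewrite le_min; apply/andP; split.
  apply: le_trans (normc_sum_le _ _ _) _.
  rewrite -[L in L%:R](card_ord L) -sumr_const; exact: ler_sum.
rewrite ler_pdivlMr // -normcM -opprB mulrN mulrC -subrX1.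
rewrite normc_opp; apply: le_trans (normcD_le _ _) _.
by rewrite normc_opp normc1 lerD.
Qed.

Definition geom_poly L : {poly R} := \poly_(i < L) 1.

(** In degrees below 2^j, scale j contributes the coefficients of
    2^(- alpha j) (1 - u)^(- n), a geometric sum being put in place of the
    singular function 1 / (1 - u).  Summing over j imitates the factor
    (n + m)^(- alpha) of the reproducing kernel in degree m. *)
Definition dyadic_poly n alpha N : {poly R} :=
  \sum_(j < N) (2 `^ (- alpha)) ^+ j *: geom_poly (2 ^ j) ^+ n.

Definition ceval (Q : {poly R}) u : R[i] := (map_poly (real_complex R) Q).[u].

Lemma cevalE Q u : ceval Q u = \sum_(m < size Q) (Q`_m)%:C%C * u ^+ m.
Proof.
rewrite /ceval horner_coef size_map_poly; apply: eq_bigr => m _.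
by rewrite coef_map.
Qed.

Lemma normc_dyadic_poly_le n alpha N u : normc u <= 1 -> u != 1 ->
  normc (ceval (dyadic_poly n alpha N) u) <=
  dyadic_sum n (2 `^ (- alpha)) N (2 / normc (1 - u)).
Proof.
move=> u1 un1; rewrite /ceval rmorph_sum horner_sum /=.
apply: le_trans (normc_sum_le _ _ _) _; apply: ler_sum => j _.
rewrite map_polyZ hornerZ !rmorphXn /= horner_exp normcM !normcX normc_real.
rewrite ger0_norm ?powR_ge0 // ler_wpM2l ?exprn_ge0 ?powR_ge0 //.
rewrite lerXn2r ?nnegrE ?normc_ge0 //.
  by rewrite le_min exprn_ge0 // divr_ge0 ?normc_ge0.
have -> : (map_poly (real_complex R) (geom_poly (2 ^ j))).[u] = \sum_(i < 2 ^ j) u ^+ i.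
  rewrite /geom_poly poly_def rmorph_sum horner_sum; apply: eq_bigr => i _ /=.
  by rewrite scale1r map_polyXn hornerXn.
by apply: le_trans (normc_geom_le _ u1 un1) _; rewrite natrX.
Qed.

Lemma coef_geom_poly_exp_ge0 L n m : 0 <= (geom_poly L ^+ n)`_m.
Proof.
elim: n m => [|n IH] m; first by rewrite expr0 coef1; case: eqP.
rewrite exprS coefM; apply: sumr_ge0 => i _; rewrite mulr_ge0 // coef_poly.
by case: ifP.
Qed.

(** In degrees below L the truncation is invisible and the coefficients are
    those of (1 - X)^(- n - 1); the induction is the hockey-stick identity. *)
Lemma coef_geom_poly_exp L n m : (m < L)%N ->
  (geom_poly L ^+ n.+1)`_m = 'C(n + m, m)%:R.
Proof.
elim: n m => [|n IH] m mL; first by rewrite expr1 coef_poly mL add0n binn.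
rewrite exprSr coefM (eq_bigr (fun i : 'I_m.+1 => ('C(n + i, i)%:R : R))); last first.
  move=> i _; rewrite IH; last by apply: leq_trans mL; exact: ltn_ord.
  by rewrite coef_poly (leq_ltn_trans (leq_subr _ _) mL) mulr1.
rewrite -natr_sum; congr _%:R; elim: m {mL} => [|m IHm].
  by rewrite big_ord1 !bin0.
by rewrite big_ord_recr /= IHm addSnnS addSn binS addnC.
Qed.

Lemma coef_dyadic_poly_ge0 n alpha N m : 0 <= (dyadic_poly n alpha N)`_m.
Proof.
rewrite coef_sum; apply: sumr_ge0 => j _; rewrite coefZ mulr_ge0 //.
exact: coef_geom_poly_exp_ge0.
Qed.

(** A single scale suffices: the j with 2^(j - 1) <= m + 1 < 2^j, for which 2^j
    is at most 2 (n + m). *)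
Lemma coef_dyadic_poly_ge n alpha N m : (0 < n)%N -> 0 <= alpha -> (m.+1 < N)%N ->
  (n + m)%:R `^ (- alpha) * 'C(n.-1 + m, m)%:R <=
  2 `^ alpha * (dyadic_poly n alpha N)`_m.
Proof.
case: n => // n _ a0 mN /=.
have tl : (2 ^ trunc_log 2 m.+1 <= m.+1 < 2 ^ (trunc_log 2 m.+1).+1)%N.
  exact: trunc_log_bounds.
set j := (trunc_log 2 m.+1).+1 in tl.
have jN : (j < N)%N.
  apply: leq_ltn_trans mN; rewrite /j; case/andP: tl => tl _.
  exact: leq_trans (ltn_expl _ _) tl.
rewrite /dyadic_poly coef_sum (bigD1 (Ordinal jN)) //= mulrDr.
apply: ler_wpDr.
  rewrite mulr_ge0 ?powR_ge0 //; apply: sumr_ge0 => i _; rewrite coefZ mulr_ge0 //.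
  exact: coef_geom_poly_exp_ge0.
rewrite coefZ coef_geom_poly_exp; last by case/andP: tl => _ /ltnW.
rewrite mulrA ler_wpM2r //.
rewrite !powRN exprVn ler_pdivlMr ?exprn_gt0 ?powR_gt0 // mulrC.
rewrite ler_pdivrMr ?powR_gt0 ?ltr0n // -powRM // -powR_mulrn ?powR_ge0 //.
rewrite -powRrM mulrC powRrM powR_mulrn //; apply: ge0_ler_powR; rewrite ?nnegrE //.
rewrite -natrX -natrM ler_nat; case/andP: tl => tl _.
by rewrite expnS leq_mul2l /= (leq_trans tl) // addSn ltnS leq_addl.
Qed.
End GeometricPolynomials.

(** * Words and the multinomial expansion *)
Section Words.
Context {n : nat}.
Implicit Types (j : 'I_n) (k : multiindex n) (s : seq 'I_n).

(** Words in the n letters index the expansion of <z,w>^m without any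
    multinomial coefficient; grouping them by content brings these back. *)
Definition content s : multiindex n := [ffun j => count_mem j s].

Lemma big_tupleS (V : Type) (idx : V) (op : Monoid.com_law idx) (T : finType) m
    (F : seq T -> V) :
  \big[op/idx]_(w : m.+1.-tuple T) F w =
  \big[op/idx]_(j : T) \big[op/idx]_(w : m.-tuple T) F (j :: w).
Proof.
rewrite pair_big (reindex (fun p : T * m.-tuple T => [tuple of p.1 :: p.2])) //=.
exists (fun w : m.+1.-tuple T => (thead w, [tuple of behead w])) => [[j w] _|w _] /=.
  by congr pair; apply: val_inj.
by rewrite -tuple_eta.
Qed.

Lemma big_tuple0 (V : Type) (idx : V) (op : Monoid.com_law idx) (T : finType)
    (F : seq T -> V) :
  \big[op/idx]_(w : 0.-tuple T) F w = F [::].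
Proof.
rewrite (big_pred1 [tuple]) // => w; rewrite (tuple0 w); apply/esym/eqP/val_inj => //.
Qed.

Definition decr k j : multiindex n := [ffun i => k i - (i == j)]%N.

Lemma content_cons_eq k j s :
  (content (j :: s) == k) = (0 < k j)%N && (content s == decr k j).
Proof.
apply/eqP/andP => [<-|[kj /eqP/ffunP E]].
  rewrite ffunE /= eqxx; split=> //; apply/eqP/ffunP => i; rewrite !ffunE /=.
  by rewrite (eq_sym i) addnC addnK.
apply/ffunP => i; have := E i; rewrite !ffunE /= (eq_sym j i).
by case: eqVneq => [->|_] /= -> //; rewrite ?subn0 // subnKC.
Qed.

Lemma mdeg_decr k j : (0 < k j)%N -> mdeg k = (mdeg (decr k j)).+1.
Proof.
move=> kj; rewrite /mdeg (bigD1 j) //= [in RHS](bigD1 j) //= ffunE eqxx.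
rewrite -addSn; congr (_ + _)%N; first by rewrite subn1 prednK.
by apply: eq_bigr => i ij; rewrite ffunE (negbTE ij) subn0.
Qed.

Lemma mfact_decr k j : (0 < k j)%N -> mfact k = (k j * mfact (decr k j))%N.
Proof.
move=> kj; rewrite /mfact (bigD1 j) //= [in RHS](bigD1 j) //= ffunE eqxx mulnA.
congr (_ * _)%N; first by rewrite subn1 -{1}(prednK kj) factS prednK.
by apply: eq_bigr => i ij; rewrite ffunE (negbTE ij) subn0.
Qed.

(** Induction on the first letter j of the word: removing it divides k! by k_j
    and the k_j add up to m. *)
Lemma card_content m k : mdeg k = m ->
  ((\sum_(w : m.-tuple 'I_n) (content w == k)) * mfact k = m`!)%N.
Proof.
elim: m k => [|m IH] k km.
  have k0 j : k j = 0%N.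
    by apply/eqP; rewrite -leqn0 -km /mdeg (bigD1 j) //= leq_addr.
  have /= -> := big_tuple0 addn (fun s => (content s == k) : nat).
  rewrite /mfact big1 => [|j _]; last by rewrite k0.
  by rewrite (_ : content [::] == k) //; apply/eqP/ffunP => j; rewrite ffunE k0.
have /= -> := big_tupleS addn m (fun s => (content s == k) : nat); rewrite big_distrl /=.
rewrite (eq_bigr (fun j => k j * m`!)%N) => [|j _].
  by rewrite -big_distrl /= -/(mdeg k) km factS.
under eq_bigr do rewrite content_cons_eq.
have [k0|kj] := posnP (k j); first by rewrite k0 /= big1.
rewrite /= (mfact_decr kj) mulnCA IH //.
by apply/eqP; rewrite -eqSS -mdeg_decr // km.
Qed.

Lemma monomial_content {R : realType} s (z : 'rV[R[i]]_n) :
  monomial (content s) z = \prod_(j <- s) z 0 j.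
Proof.
elim: s => [|j s IH].
  by rewrite big_nil /monomial big1 // => i _; rewrite ffunE expr0.
rewrite big_cons -IH /monomial; rewrite (eq_bigr (fun i =>
   (if i == j then z 0 j else 1) * z 0 i ^+ content s i)) => [|i _].
  by rewrite big_split /= -big_mkcond /= big_pred1_eq.
rewrite !ffunE /= (eq_sym j); case: eqVneq => [->|_].
  by rewrite add1n exprS.
by rewrite add0n mul1r.
Qed.

Lemma inner_exp {R : realType} m (z w : 'rV[R[i]]_n) :
  inner z w ^+ m =
  \sum_(s : m.-tuple 'I_n) monomial (content s) z * ((monomial (content s) w)^*)%C.
Proof.
under eq_bigr do rewrite !monomial_content.
elim: m => [|m IH].
  rewrite expr0; have /= -> := big_tuple0 (@GRing.add R[i])
    (fun s => (\prod_(j <- s) z 0 j) * ((\prod_(j <- s) w 0 j)^*)%C).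
  by rewrite !big_nil rmorph1 mulr1.
have /= -> := big_tupleS (@GRing.add R[i]) m
  (fun s => (\prod_(j <- s) z 0 j) * ((\prod_(j <- s) w 0 j)^*)%C).
rewrite exprS IH /inner mulr_suml; apply: eq_bigr => j _.
rewrite mulr_sumr; apply: eq_bigr => s _; rewrite !big_cons rmorphM.
by rewrite mulrACA.
Qed.

End Words.

(** * Integrals of complex functions *)
Section ComplexIntegral.
Context d (T : measurableType d) (R : realType).
Context (mu : probability T R) (D : set T) (mD : measurable D).
Implicit Types (g h : T -> R[i]).

Definition cmeasurable g :=
  measurable_fun D (fun x => Re (g x)) /\ measurable_fun D (fun x => Im (g x)).

Lemma ReM (x y : R[i]) : Re (x * y) = Re x * Re y - Im x * Im y.
Proof. by case: x y => a b [c e]. Qed.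

Lemma ImM (x y : R[i]) : Im (x * y) = Re x * Im y + Im x * Re y.
Proof. by case: x y => a b [c e]. Qed.

Lemma ReD (x y : R[i]) : Re (x + y) = Re x + Re y.
Proof. by case: x y => a b [c e]. Qed.

Lemma ImD (x y : R[i]) : Im (x + y) = Im x + Im y.
Proof. by case: x y => a b [c e]. Qed.

Lemma cmeasurable_cst c : cmeasurable (fun=> c).
Proof. by split; exact: measurable_cst. Qed.

Lemma cmeasurableD g h : cmeasurable g -> cmeasurable h ->
  cmeasurable (fun x => g x + h x).
Proof.
move=> [g1 g2] [h1 h2]; split.
  by under eq_fun do rewrite ReD; exact: measurable_funD.
by under eq_fun do rewrite ImD; exact: measurable_funD.
Qed.

Lemma cmeasurableM g h : cmeasurable g -> cmeasurable h ->
  cmeasurable (fun x => g x * h x).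
Proof.
move=> [g1 g2] [h1 h2]; split.
  under eq_fun do rewrite ReM.
  by apply: measurable_funB; exact: measurable_funM.
under eq_fun do rewrite ImM.
by apply: measurable_funD; exact: measurable_funM.
Qed.

Lemma cmeasurable_conj g : cmeasurable g -> cmeasurable (fun x => ((g x)^*)%C).
Proof.
move=> [g1 g2]; split.
  by rewrite (_ : (fun x => _) = fun x => Re (g x)) //; apply/funext => x; case: (g x).
rewrite (_ : (fun x => _) = fun x => - Im (g x)).
  by apply: measurable_funN.
by apply/funext => x; case: (g x).
Qed.

Lemma cmeasurable_sum (I : Type) (r : seq I) (F : I -> T -> R[i]) :
  (forall i, cmeasurable (F i)) -> cmeasurable (fun x => \sum_(i <- r) F i x).
Proof.
move=> mF; elim: r => [|i r IH].
  by under eq_fun do rewrite big_nil; exact: cmeasurable_cst.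
by under eq_fun do rewrite big_cons; exact: cmeasurableD.
Qed.

Lemma cmeasurable_prod (I : Type) (r : seq I) (F : I -> T -> R[i]) :
  (forall i, cmeasurable (F i)) -> cmeasurable (fun x => \prod_(i <- r) F i x).
Proof.
move=> mF; elim: r => [|i r IH].
  by under eq_fun do rewrite big_nil; exact: cmeasurable_cst.
by under eq_fun do rewrite big_cons; exact: cmeasurableM.
Qed.

Lemma cmeasurable_exp g k : cmeasurable g -> cmeasurable (fun x => g x ^+ k).
Proof.
move=> mg; elim: k => [|k IH].
  by under eq_fun do rewrite expr0; exact: cmeasurable_cst.
by under eq_fun do rewrite exprS; exact: cmeasurableM.
Qed.

Lemma normcE_ReIm (x : R[i]) : normc x = Num.sqrt (Re x ^+ 2 + Im x ^+ 2).
Proof. by case: x. Qed.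

Lemma sqr_normcE (x : R[i]) : normc x ^+ 2 = Re x ^+ 2 + Im x ^+ 2.
Proof. by rewrite normcE_ReIm sqr_sqrtr ?addr_ge0 ?sqr_ge0. Qed.

Lemma le_Re_normc (x : R[i]) : `|Re x| <= normc x.
Proof.
by rewrite normcE_ReIm -sqrtr_sqr ler_wsqrtr // lerDl sqr_ge0.
Qed.

Lemma le_Im_normc (x : R[i]) : `|Im x| <= normc x.
Proof.
by rewrite normcE_ReIm -sqrtr_sqr ler_wsqrtr // lerDr sqr_ge0.
Qed.

Lemma measurable_normc g : cmeasurable g -> measurable_fun D (fun x => normc (g x)).
Proof.
move=> [g1 g2]; under eq_fun do rewrite normcE_ReIm.
apply: (measurableT_comp (continuous_measurable_fun _)); first exact: sqrt_continuous.
by apply: measurable_funD; exact: measurable_funX.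
Qed.

Definition cbounded g := cmeasurable g /\ exists M, forall x, D x -> normc (g x) <= M.

Lemma bounded_integrable (f : T -> R) M : measurable_fun D f ->
  (forall x, D x -> `|f x| <= M) -> mu.-integrable D (EFin \o f).
Proof.
move=> mf fM; apply: measurable_bounded_integrable => //.
  by apply: le_lt_trans (probability_le1 mu mD) _; exact: ltry.
exists M; split; first exact: num_real.
by move=> y My x Dx; apply: le_trans (fM x Dx) (ltW My).
Qed.

Definition cint g : R[i] :=
  (\int[mu]_(x in D) Re (g x) +i* \int[mu]_(x in D) Im (g x))%C.

Lemma cbounded_integrable g : cbounded g ->
  mu.-integrable D (EFin \o (fun x => Re (g x))) /\
  mu.-integrable D (EFin \o (fun x => Im (g x))).
Proof.
move=> [[g1 g2] [M gM]]; split; apply: (bounded_integrable (M := M)) => // x Dx.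
  exact: le_trans (le_Re_normc _) (gM x Dx).
exact: le_trans (le_Im_normc _) (gM x Dx).
Qed.

Lemma cbounded_lin (I : Type) (r : seq I) (c : I -> R[i]) (F : I -> T -> R[i]) :
  (forall i, cbounded (F i)) -> cbounded (fun x => \sum_(i <- r) c i * F i x).
Proof.
move=> bF; split.
  apply: cmeasurable_sum => i; apply: cmeasurableM; first exact: cmeasurable_cst.
  by case: (bF i).
elim: r => [|i r [M IH]].
  by exists 0 => x _; rewrite big_nil normc0.
have [_ [N hN]] := bF i; exists (normc (c i) * N + M) => x Dx.
rewrite big_cons (le_trans (normcD_le _ _)) // lerD ?IH //.
by rewrite normcM ler_wpM2l ?hN // normc_ge0.
Qed.

(** Linearity of the integral, under the real part, which is the only way in
    which complex integrals are compared with real ones. *)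
Lemma Re_sum_cint (I : Type) (r : seq I) (c : I -> R[i]) (F : I -> T -> R[i]) :
  (forall i, cbounded (F i)) ->
  Re (\sum_(i <- r) c i * cint (F i)) =
  \int[mu]_(x in D) Re (\sum_(i <- r) c i * F i x).
Proof.
move=> bF; elim: r => [|i r IH].
  rewrite big_nil; under eq_Rintegral do rewrite big_nil /=.
  by rewrite Rintegral_cst // mul0r.
have [i1 i2] := cbounded_integrable (bF i).
have j1 := integrableZl mD (Re (c i)) i1.
have j2 := integrableZl mD (Im (c i)) i2.
rewrite big_cons ReD IH; under [in RHS]eq_Rintegral do rewrite big_cons ReD.
rewrite RintegralD //; last 2 first.
- under eq_fun do rewrite ReM; exact: (integrableB mD j1 j2).
- exact: (cbounded_integrable (cbounded_lin r c bF)).1.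
congr (_ + _); under [in RHS]eq_Rintegral do rewrite ReM.
by rewrite RintegralB // !RintegralZl // ReM.
Qed.

Lemma normc_conj (x : R[i]) : normc (x^*)%C = normc x.
Proof. by case: x => a b; rewrite /normc /= sqrrN. Qed.

Lemma Re_conj (x : R[i]) : Re (x^*)%C = Re x.
Proof. by case: x. Qed.

Lemma conjM (x y : R[i]) : ((x * y)^*)%C = (x^*)%C * (y^*)%C.
Proof. exact: rmorphM. Qed.

Lemma conj_real (x : R) : ((x%:C)^*)%C = x%:C%C.
Proof. by rewrite /= oppr0. Qed.

Lemma Re_mul_conj (x : R[i]) : Re (x * (x^*)%C) = normc x ^+ 2.
Proof. by rewrite sqr_normcE ReM; case: x => a b /=; ring. Qed.

(** The integral of a nonnegative function is a supremum over the simple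
    functions below it, so the larger function need not be measurable.  This
    spares a study of the measurability of the potential of the kernel. *)
Lemma le_integral_upper (f G : T -> \bar R) :
  (forall x, D x -> 0 <= f x)%E -> (forall x, D x -> f x <= G x)%E ->
  (\int[mu]_(x in D) f x <= \int[mu]_(x in D) G x)%E.
Proof.
move=> f0 fG.
have G0 x : D x -> (0 <= G x)%E by move=> Dx; apply: le_trans (f0 x Dx) (fG x Dx).
rewrite !ge0_integralE //; apply: le_ereal_sup => _ [h hf <-]; exists h => // x.
apply: le_trans (hf x) _; rewrite /patch; case: ifPn => // /set_mem; exact: fG.
Qed.

(** The constant C is moved to the side of f, which is measurable, before
    comparing; a possibly nonmeasurable G cannot be scaled as easily. *)
Lemma le_Rintegral_upper (f : T -> R) M (G : T -> \bar R) C : 0 < C ->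
  measurable_fun D f -> (forall x, D x -> `|f x| <= M) ->
  (forall x, D x -> 0 <= G x)%E -> (forall x, D x -> (f x)%:E <= C%:E * G x)%E ->
  ((\int[mu]_(x in D) f x)%:E <= C%:E * \int[mu]_(x in D) G x)%E.
Proof.
move=> C0 mf fM G0 fG.
pose g x := C^-1 * Num.max (f x) 0.
have mg : measurable_fun D g by apply: measurable_funM => //; exact: measurable_maxr.
have g0 x : 0 <= g x by rewrite mulr_ge0 ?invr_ge0 ?(ltW C0) // le_max lexx orbT.
have gM x : D x -> `|g x| <= C^-1 * M.
  move=> Dx; rewrite ger0_norm // ler_pM2l ?invr_gt0 // ge_max.
  by rewrite (le_trans (ler_norm _) (fM x Dx)) (le_trans (normr_ge0 _) (fM x Dx)).
have ig := bounded_integrable mg gM.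
apply: (@le_trans _ _ (C%:E * \int[mu]_(x in D) (g x)%:E)%E); last first.
  rewrite lee_pmul2l ?lte_fin //; apply: le_integral_upper => x Dx; rewrite ?lee_fin //.
  have := fG x Dx; have := G0 x Dx; case: (G x) => [y| |] //=; rewrite ?leey // -EFinM !lee_fin.
  by move=> y0 fy; rewrite /g ler_pdivrMl // ge_max fy mulr_ge0 // ltW.
have -> : (\int[mu]_(x in D) (g x)%:E)%E = (\int[mu]_(x in D) g x)%:E.
  by rewrite /Rintegral fineK //; exact: integral_fune_fin_num.
rewrite -EFinM lee_fin -RintegralZl //; apply: le_Rintegral => //.
- exact: bounded_integrable fM.
- exact: (integrableZl mD C ig).
- by move=> x Dx; rewrite /g mulVKf ?gt_eqF // le_max lexx.
Qed.

(** Writing |H|^2 = Re (H conj H) and integrating twice turns a sum of squared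
    moments into the double integral of the kernel sum_i b_i F_i(x) conj(F_i(y)),
    which may then be compared pointwise with K. *)
Lemma sum_sqr_cint_le (I : Type) (r : seq I) (b : I -> R) (F : I -> T -> R[i])
    (C : R) (K : T -> T -> \bar R) : 0 < C ->
  (forall i, cbounded (F i)) ->
  (forall x y, D x -> D y -> 0 <= K x y)%E ->
  (forall x y, D x -> D y ->
    ((Re (\sum_(i <- r) (b i)%:C%C * F i x * ((F i y)^*)%C))%:E <= C%:E * K x y)%E) ->
  ((\sum_(i <- r) b i * normc (cint (F i)) ^+ 2)%:E <=
     C%:E * \int[mu]_(x in D) \int[mu]_(y in D) K x y)%E.
Proof.
move=> C0 bF K0 hK.
have -> : \sum_(i <- r) b i * normc (cint (F i)) ^+ 2 =
    Re (\sum_(i <- r) (b i)%:C%C * ((cint (F i))^*)%C * cint (F i)).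
  rewrite raddf_sum; apply: eq_bigr => i _; rewrite -[RHS]/(Re _).
  by rewrite -mulrA [(_^*)%C * _]mulrC -Re_mul_conj [RHS]ReM /= mul0r subr0.
have bG := cbounded_lin r (fun i => (b i)%:C%C * ((cint (F i))^*)%C) bF.
rewrite (Re_sum_cint _ (fun i => (b i)%:C%C * ((cint (F i))^*)%C)) //.
case: bG => [[m1 _] [M hM]]; apply: (le_Rintegral_upper (M := M)) => //.
- by move=> x Dx; apply: le_trans (le_Re_normc _) (hM x Dx).
- by move=> x Dx; apply: integral_ge0 => y Dy; exact: K0.
move=> x Dx.
have -> : Re (\sum_(i <- r) (b i)%:C%C * ((cint (F i))^*)%C * F i x) =
    \int[mu]_(y in D) Re (\sum_(i <- r) ((b i)%:C%C * ((F i x)^*)%C) * F i y).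
  rewrite -Re_sum_cint // -Re_conj rmorph_sum; congr Re; apply: eq_bigr => i _.
  by rewrite -[LHS]/((_ * _ * _)^*)%C !conjM conj_real conjcK mulrAC.
have [[m2 _] [N hN]] := cbounded_lin r (fun i => (b i)%:C%C * ((F i x)^*)%C) bF.
apply: (le_Rintegral_upper (M := N)) => //.
- by move=> y Dy; apply: le_trans (le_Re_normc _) (hN y Dy).
- by move=> y Dy; exact: K0.
move=> y Dy; apply: le_trans (hK _ _ Dx Dy); rewrite lee_fin -Re_conj rmorph_sum.
rewrite le_eqVlt; apply/orP; left; apply/eqP; congr Re; apply: eq_bigr => i _.
by rewrite -[LHS]/((_ * _ * _)^*)%C !conjM conj_real conjcK.
Qed.

End ComplexIntegral.

(** * Topology of the complex numbers and Borel functions on C^n *)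
Section ComplexTopology.
Context {R : realType}.
Implicit Types (u v l : R[i]).

Lemma norm_normc u : `|u| = (normc u)%:C%C.
Proof. by []. Qed.

(** The balls of R[i] have complex radii, which are positive only when real;
    this reduces limits to real epsilons. *)
Lemma cvg_normcP (T : Type) (F : set_system T) {FF : Filter F} (f : T -> R[i]) l :
  f @ F --> l <-> forall e : R, 0 < e -> \forall x \near F, normc (l - f x) < e.
Proof.
split=> [/cvgrPdist_lt H e e0|H].
  have := H e%:C%C; rewrite ltcR => /(_ e0); apply: filterS => x.
  by rewrite norm_normc ltcR.
apply/cvgrPdist_lt => e; rewrite ltcE /= => /andP[/eqP ei e0].
by apply: filterS (H _ e0) => x Hx; rewrite norm_normc ltcE /= ei eqxx.
Qed.

Lemma nbhs_normc (u : R[i]) (e : R) : 0 < e -> \forall v \near u, normc (u - v) < e.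
Proof.
by move=> e0; apply: (cvg_normcP (FF := nbhs_filter u) id u).1 => //; exact: cvg_id.
Qed.

Lemma continuous_Re : continuous (@complex.Re R : R[i] -> R).
Proof.
move=> x; have FF := nbhs_filter x; apply/cvgrPdist_lt => e e0.
have := nbhs_normc x e0; apply: filterS => y; apply: le_lt_trans.
apply: le_trans (le_Re_normc _); rewrite (_ : complex.Re (x - y) = complex.Re x - complex.Re y) //.
by case: (x) (y) => a b [c d].
Qed.

Lemma continuous_Im : continuous (@complex.Im R : R[i] -> R).
Proof.
move=> x; have FF := nbhs_filter x; apply/cvgrPdist_lt => e e0.
have := nbhs_normc x e0; apply: filterS => y; apply: le_lt_trans.
apply: le_trans (le_Im_normc _); rewrite (_ : complex.Im (x - y) = complex.Im x - complex.Im y) //.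
by case: (x) (y) => a b [c d].
Qed.

Lemma normc_sub_le u v : `|normc u - normc v| <= normc (u - v).
Proof.
have H (a b : R[i]) : normc a - normc b <= normc (a - b).
  by rewrite lerBlDr (le_trans _ (normcD_le _ _)) // subrK.
by rewrite ler_norml H andbT lerNl opprB -(normc_opp (u - v)) opprB H.
Qed.

Lemma continuous_normc : continuous (@normc R : R[i] -> R).
Proof.
move=> x; have FF := nbhs_filter x; apply/cvgrPdist_lt => e e0.
have := nbhs_normc x e0; by apply: filterS => y; apply: le_lt_trans; exact: normc_sub_le.
Qed.

End ComplexTopology.

Section BorelCn.
Context {R : realType} {n : nat}.
Implicit Types (f : 'rV[R[i]]_n -> R) (k : multiindex n).

Lemma borelCn_continuous (D : set (borelCn R n)) f :
  continuous f -> measurable_fun D (f : borelCn R n -> R).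
Proof.
move=> cf; apply: measurable_funTS.
apply: (measurability _ (RGenOpens.measurableE R)).
move=> _ [_ [a [b ->] <-]]; rewrite setTI; apply: sub_sigma_algebra.
by move/continuousP : cf; apply; exact: interval_open.
Qed.

Lemma cmeasurable_coord (D : set (borelCn R n)) j :
  cmeasurable D (fun z : borelCn R n => (z : 'rV[R[i]]_n) 0 j).
Proof.
split; apply: (@borelCn_continuous D (fun z => _ (z 0 j))).
  by move=> z; apply: (@continuous_comp _ _ _ (fun z : 'rV[R[i]]_n => z 0 j));
    [exact: coord_continuous|exact: continuous_Re].
by move=> z; apply: (@continuous_comp _ _ _ (fun z : 'rV[R[i]]_n => z 0 j));
  [exact: coord_continuous|exact: continuous_Im].
Qed.

Lemma cmeasurable_monomial (D : set (borelCn R n)) k :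
  cmeasurable D (monomial k : borelCn R n -> R[i]).
Proof.
by apply: cmeasurable_prod => j; apply: cmeasurable_exp; exact: cmeasurable_coord.
Qed.

Lemma measurable_sphere1 : measurable (sphere1 R n : set (borelCn R n)).
Proof.
have mq : measurable_fun setT (sqnorm : borelCn R n -> R).
  apply: measurable_sum => j; apply: measurable_funX.
  by apply: measurable_normc => //; exact: cmeasurable_coord.
have := mq measurableT [set 1] (measurable_set1 _).
by rewrite setTI; congr measurable.
Qed.

End BorelCn.

Section Sphere.
Context {R : realType} {n : nat}.
Implicit Types (z w : 'rV[R[i]]_n) (k : multiindex n).

Lemma normc_inner_le1 z w : sphere1 R n z -> sphere1 R n w -> normc (inner z w) <= 1.
Proof.
rewrite /sphere1 /= => z1 w1; apply: le_trans (normc_sum_le _ _ _) _.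
apply: (@le_trans _ _ ((sqnorm z + sqnorm w) / 2)); last by rewrite z1 w1 divff.
rewrite /sqnorm -big_split /= mulr_suml; apply: ler_sum => j _.
rewrite normcM normc_conj; have := sqr_ge0 (normc (z 0 j) - normc (w 0 j)); nra.
Qed.

Lemma normc_monomial z k : normc (monomial k z) = \prod_j normc (z 0 j) ^+ k j.
Proof.
rewrite /monomial; elim/big_rec2: _ => [|j x y _ <-]; first by rewrite normc1.
by rewrite normcM normcX.
Qed.

Lemma normc_monomial_le1 z k : sqnorm z <= 1 -> normc (monomial k z) <= 1.
Proof.
move=> z1; rewrite normc_monomial; apply: prodr_ile1 => j _.
rewrite exprn_ge0 ?normc_ge0 //= exprn_ile1 ?normc_ge0 //.
rewrite -(ler_pXn2r (n := 2)) ?nnegrE ?normc_ge0 ?ler01 // expr1n.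
apply: le_trans z1; rewrite /sqnorm (bigD1 j) //= lerDl.
by apply: sumr_ge0 => i _; exact: sqr_ge0.
Qed.

End Sphere.

(** * Finite energy embeds polynomials into L^1 *)
Section Embedding.
Context {R : realType} {n : nat}.
Implicit Types (alpha : R) (k : multiindex n) (mu : probability (borelCn R n) R).

Lemma cauchy_schwarz_sum (I : Type) (r : seq I) (x y : I -> R) :
  (\sum_(i <- r) x i * y i) ^+ 2 <=
  (\sum_(i <- r) x i ^+ 2) * (\sum_(i <- r) y i ^+ 2).
Proof.
have ge0 (f : I -> R) s : 0 <= \sum_(i <- s) f i ^+ 2 by apply: sumr_ge0 => i _; exact: sqr_ge0.
set X := \sum_(i <- r) x i ^+ 2; set Y := \sum_(i <- r) y i ^+ 2; set Z := \sum_(i <- r) _.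
(* the sum of the squares of t x_i - y_i, a quadratic polynomial in t *)
have H (t : R) : 0 <= t ^+ 2 * X - 2 * t * Z + Y.
  have -> : t ^+ 2 * X - 2 * t * Z + Y = \sum_(i <- r) (t * x i - y i) ^+ 2.
    rewrite /X /Y /Z !mulr_sumr -sumrB -big_split /=.
    by apply: eq_bigr => i _; ring.
  exact: ge0.
have X0 : 0 <= X := ge0 x r; have Y0 : 0 <= Y := ge0 y r.
have [X00|Xn0] := eqVneq X 0.
  have := H ((Y + 1) / Z); rewrite X00 mul0r.
  have [->|Zn0] := eqVneq Z 0; first by rewrite expr0n.
  have -> : ((Y + 1) / Z) ^+ 2 * 0 - 2 * ((Y + 1) / Z) * Z + Y = - Y - 2 by field.
  by move=> ?; exfalso; lra.
have := H (Z / X).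
have -> : (Z / X) ^+ 2 * X - 2 * (Z / X) * Z + Y = (X * Y - Z ^+ 2) / X by field.
by rewrite pmulr_lge0 ?invr_gt0 ?lt_def ?Xn0 // subr_ge0.
Qed.

Lemma weight_gt0 alpha k : (0 < n)%N -> 0 < weight alpha k.
Proof.
move=> n0; rewrite mulr_gt0 ?powR_gt0 ?divr_gt0 ?ltr0n ?fact_gt0 ?addn_gt0 ?n0 //.
by rewrite muln_gt0 fact_gt0 prodn_gt0 // => j; exact: fact_gt0.
Qed.

Lemma mfact_gt0 k : (0 < mfact k)%N.
Proof. by rewrite prodn_gt0 // => j; exact: fact_gt0. Qed.

Lemma weightV alpha k :
  (weight alpha k)^-1 = (n + mdeg k)%:R `^ (- alpha) *
    'C(n.-1 + mdeg k, mdeg k)%:R * ((mdeg k)`!%:R / (mfact k)%:R).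
Proof.
rewrite /weight; have := bin_fact (leq_addl n.-1 (mdeg k)); rewrite addnK => <-.
rewrite powRN !natrM; set x := _ `^ _.
have nz m : (m`!)%:R != 0 :> R by rewrite pnatr_eq0 -lt0n fact_gt0.
have k0 : (mfact k)%:R != 0 :> R by rewrite pnatr_eq0 -lt0n mfact_gt0.
have [-> | x0] := eqVneq x 0; first by rewrite mul0r invr0 !mul0r.
have c0 : ('C(n.-1 + mdeg k, mdeg k))%:R != 0 :> R.
  by rewrite pnatr_eq0 -lt0n bin_gt0 leq_addl.
by field; rewrite x0 k0 !nz c0.
Qed.

Definition word_contents m : seq (multiindex n) :=
  [seq content (tval w) | w <- enum {: m.-tuple 'I_n}].

Lemma count_word_contents k :
  (mdeg k)`!%:R / (mfact k)%:R = \sum_(l <- word_contents (mdeg k)) (l == k)%:R :> R.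
Proof.
rewrite /word_contents big_map big_enum /= -natr_sum -(card_content (erefl (mdeg k))).
by rewrite natrM mulfK // pnatr_eq0 -lt0n mfact_gt0.
Qed.

(** 1 / w_k is at most 2^alpha times the coefficient of the dyadic polynomial in
    degree |k| times |k|!/k!, the number of words of content k. *)
Lemma sum_weightV_le alpha N (J : {fset multiindex n}) (H : multiindex n -> R) :
  (0 < n)%N -> 0 <= alpha -> (forall k, k \in J -> (mdeg k).+1 < N)%N ->
  (forall k, 0 <= H k) ->
  \sum_(k <- J) (weight alpha k)^-1 * H k <=
  2 `^ alpha * \sum_(m < size (dyadic_poly n alpha N))
     (dyadic_poly n alpha N)`_m * \sum_(l <- word_contents m) H l.
Proof.
move=> n0 a0 JN H0; set Q := dyadic_poly n alpha N.
have step l : \sum_(k <- J) (l == k)%:R * H k <= H l.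
  have [lJ|lJ] := boolP (l \in J).
    rewrite (bigD1_seq l) //= eqxx mul1r big1 ?addr0 // => k kl.
    by rewrite eq_sym (negbTE kl) mul0r.
  rewrite big1_seq // => k /andP[_ kJ]; case: eqVneq => [E|_]; last by rewrite mul0r.
  by rewrite E kJ in lJ.
apply: (@le_trans _ _ (2 `^ alpha * \sum_(m < size Q) Q`_m *
    \sum_(l <- word_contents m) \sum_(k <- J) (l == k)%:R * H k)); last first.
  rewrite ler_wpM2l ?powR_ge0 //; apply: ler_sum => m _.
  by rewrite ler_wpM2l ?coef_dyadic_poly_ge0 //; apply: ler_sum => l _; exact: step.
under [X in _ <= _ * X]eq_bigr do rewrite exchange_big mulr_sumr /=.
rewrite exchange_big /= mulr_sumr big_seq [X in _ <= X]big_seq.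
apply: ler_sum => k kJ; under eq_bigr do rewrite -mulr_suml mulrA.
rewrite -mulr_suml mulrA ler_wpM2r // weightV count_word_contents.
have cge := @coef_dyadic_poly_ge R n alpha N (mdeg k) n0 a0 (JN k kJ).
have s0 m : 0 <= \sum_(l <- word_contents m) (l == k)%:R :> R by apply: sumr_ge0.
apply: (le_trans (ler_wpM2r (s0 _) cge)).
rewrite -mulrA ler_wpM2l ?powR_ge0 //.
have [mQ|mQ] := ltnP (mdeg k) (size Q); last first.
  rewrite nth_default // mul0r; apply: sumr_ge0 => m _.
  by rewrite mulr_ge0 ?coef_dyadic_poly_ge0.
rewrite (bigD1 (Ordinal mQ)) //= lerDl; apply: sumr_ge0 => m _.
by rewrite mulr_ge0 ?coef_dyadic_poly_ge0.
Qed.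

Lemma ceval_inner (Q : {poly R}) (z w : 'rV[R[i]]_n) :
  ceval Q (inner z w) = \sum_(m < size Q) \sum_(l <- word_contents m)
    (Q`_m)%:C%C * (monomial l z * ((monomial l w)^*)%C).
Proof.
rewrite cevalE; apply: eq_bigr => m _.
by rewrite inner_exp mulr_sumr /word_contents big_map big_enum.
Qed.

Lemma normc_1Binner_le2 (z w : 'rV[R[i]]_n) : sphere1 R n z -> sphere1 R n w ->
  normc (1 - inner z w) <= 2.
Proof.
move=> z1 w1; rewrite (le_trans (normcD_le _ _)) // normc1 normc_opp.
by rewrite -[2]/(1 + 1) lerD2l normc_inner_le1.
Qed.

(** At a pair of points with <z,w> = 1 the kernel is infinite, so there is
    nothing to prove where the geometric sums lose their closed form. *)
Lemma dyadic_kernel_le alpha : 0 < alpha <= n%:R ->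
  exists2 C : R, 0 < C & forall N (z w : 'rV[R[i]]_n),
    sphere1 R n z -> sphere1 R n w ->
    (0 <= riesz_kernel n alpha (normc (1 - inner z w)%R))%E /\
    ((normc (ceval (dyadic_poly n alpha N) (inner z w)))%:E <=
     C%:E * riesz_kernel n alpha (normc (1 - inner z w)%R))%E.
Proof.
move=> /dyadic_sum_le_riesz[C C0 H]; exists C => // N z w z1 w1.
have t02 : 0 <= normc (1 - inner z w) <= 2 by rewrite normc_ge0 normc_1Binner_le2.
split.
  (* the empty sum is 0, so its bound says that the kernel is nonnegative *)
  have := H 0%N _ t02; rewrite /dyadic_sum big_ord0.
  by rewrite pmule_rge0 ?lte_fin.
have [u1|un1] := eqVneq (inner z w) 1.
  by rewrite u1 subrr normc0 /riesz_kernel eqxx gt0_muley ?lte_fin // leey.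
apply: le_trans (H N _ t02); rewrite lee_fin normc_dyadic_poly_le //.
exact: normc_inner_le1.
Qed.

(** Duality with c = conj p / |p|, Cauchy-Schwarz with the weights, and
    comparison of sum_k |H_k|^2 / w_k with the energy through the dyadic
    kernel.  The bound does not depend on the degree N at which the kernel is
    cut, so that N may be chosen after J. *)
Lemma dirichlet_embedding alpha mu : 0 < alpha <= n%:R -> (energy alpha mu < +oo)%E ->
  exists2 B : R, 0 <= B & forall (J : {fset multiindex n}) (a : multiindex n -> R[i]),
    (\int[mu]_(z in sphere1 R n) (normc (\sum_(k <- J) a k * monomial k z))%:E <=
     (Num.sqrt (B * \sum_(k <- J) weight alpha k * normc (a k) ^+ 2))%:E)%E.
Proof.
move=> ha fe; have /andP[a0 an] := ha.
have n0 : (0 < n)%N by move: (lt_le_trans a0 an); rewrite ltr0n.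
have [C C0 kerC] := dyadic_kernel_le ha.
set S := sphere1 R n : set (borelCn R n).
have mS : measurable S := measurable_sphere1.
have ker0 z w : S z -> S w -> (0 <= riesz_kernel n alpha (normc (1 - inner z w)%R))%E.
  by move=> z1 w1; case: (kerC 0%N z w z1 w1).
have E0 : (0 <= energy alpha mu)%E.
  by apply: integral_ge0 => z Sz; apply: integral_ge0 => w Sw; exact: ker0.
have Efin : (energy alpha mu = (fine (energy alpha mu))%:E).
  by rewrite fineK // ge0_fin_numE.
exists (2 `^ alpha * (C * fine (energy alpha mu))).
  by rewrite mulr_ge0 ?powR_ge0 // mulr_ge0 ?(ltW C0) // fine_ge0.
move=> J a; pose p (z : borelCn R n) := \sum_(k <- J) a k * monomial k z.
have bmon k : cbounded S (monomial k : borelCn R n -> R[i]).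
  split; first exact: cmeasurable_monomial.
  by exists 1 => z Sz; rewrite normc_monomial_le1 // Sz.
have bp : cbounded S p by exact: cbounded_lin.
(* conj p / |p|, and 0 at the zeros of p since the inverse of 0 is 0 *)
pose c (z : borelCn R n) : R[i] := ((p z)^*)%C * ((normc (p z))^-1)%:C%C.
have normV (u : R[i]) : (normc u)^-1 = normc u `^ (-1).
  by rewrite powR_inv1 // normc_ge0.
have mc : cmeasurable S c.
  apply: cmeasurableM; first by apply: cmeasurable_conj; case: bp.
  split; last exact: measurable_cst.
  rewrite /=; under eq_fun do rewrite normV.
  apply: (measurableT_comp (measurable_powR _)).
  by apply: measurable_normc => //; case: bp.
have c1 z : normc (c z) <= 1.
  rewrite /c normcM normc_conj normc_real ger0_norm ?invr_ge0 ?normc_ge0 //.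
  have [->|pn] := eqVneq (normc (p z)) 0; first by rewrite mul0r ler01.
  by rewrite divff.
have cp z : Re (c z * p z) = normc (p z).
  rewrite /c mulrAC [_ * p z]mulrC ReM Re_mul_conj /= mulr0 subr0.
  have [->|pn] := eqVneq (normc (p z)) 0; first by rewrite expr0n mul0r.
  by rewrite expr2 mulfK.
pose F k (z : borelCn R n) := c z * monomial k z.
have bF k : cbounded S (F k).
  split; first by apply: cmeasurableM => //; exact: cmeasurable_monomial.
  exists 1 => z Sz; rewrite normcM mulr_ile1 ?normc_ge0 //.
  by rewrite normc_monomial_le1 // Sz.
have intE : (\int[mu]_(z in S) (normc (p z))%:E)%E = (\int[mu]_(z in S) normc (p z))%:E.
  rewrite /Rintegral fineK //; apply: integral_fune_fin_num => //.
  have [mp [M hM]] := bp.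
  apply: (@bounded_integrable _ _ _ mu S mS _ M); first exact: measurable_normc.
  by move=> z Sz; rewrite ger0_norm ?normc_ge0 // hM.
rewrite -/(p _) intE lee_fin.
have -> : \int[mu]_(z in S) normc (p z) = Re (\sum_(k <- J) a k * cint mu S (F k)).
  rewrite Re_sum_cint //; apply: eq_Rintegral => z _; rewrite -cp; congr Re.
  by rewrite /p mulr_sumr; apply: eq_bigr => k _; rewrite mulrCA.
apply: (le_trans (ler_norm _)); apply: (le_trans (le_Re_normc _)).
apply: (le_trans (normc_sum_le _ _ _)).
under eq_bigr do rewrite normcM.
rewrite -[X in X <= _]ger0_norm; last first.
  by apply: sumr_ge0 => k _; rewrite mulr_ge0 ?normc_ge0.
rewrite -sqrtr_sqr ler_wsqrtr //.
set w := weight alpha; have w0 k : 0 < w k := weight_gt0 alpha k n0.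
have -> : \sum_(k <- J) normc (a k) * normc (cint mu S (F k)) =
  \sum_(k <- J) (Num.sqrt (w k) * normc (a k)) *
                ((Num.sqrt (w k))^-1 * normc (cint mu S (F k))).
  apply: eq_bigr => k _; rewrite mulrACA divff ?mul1r //.
  by rewrite gt_eqF // sqrtr_gt0.
apply: (le_trans (cauchy_schwarz_sum _ _ _)).
rewrite mulrC; under [X in X * _ <= _]eq_bigr do rewrite exprMn exprVn sqr_sqrtr ?ltW //.
under [X in _ * X <= _]eq_bigr do rewrite exprMn sqr_sqrtr ?ltW //.
rewrite ler_wpM2r //.
  by apply: sumr_ge0 => k _; rewrite mulr_ge0 ?sqr_ge0 // ltW.
(* large enough for every degree occurring in J to be below N - 1 *)
pose N := (\max_(k <- J) mdeg k).+2.
have JN k : k \in J -> ((mdeg k).+1 < N)%N.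
  by move=> kJ; rewrite /N ltnS ltnS (leq_bigmax_seq _ kJ).
have H0 k : 0 <= normc (cint mu S (F k)) ^+ 2 by exact: sqr_ge0.
apply: (le_trans (sum_weightV_le n0 (ltW a0) JN H0)).
rewrite ler_wpM2l ?powR_ge0 // -lee_fin EFinM -Efin.
set Q := dyadic_poly n alpha N.
pose r := [seq ((Q`_m, l) : R * multiindex n) | m <- iota 0 (size Q), l <- word_contents m].
have rE (V : nmodType) (G : R -> multiindex n -> V) :
    \sum_(m < size Q) \sum_(l <- word_contents m) G Q`_m l = \sum_(q <- r) G q.1 q.2.
  rewrite big_allpairs_dep /= -[X in iota 0 X]subn0 -/(index_iota 0 (size Q)).
  by rewrite big_mkord.
under eq_bigr do rewrite mulr_sumr.
rewrite (rE _ (fun x l => x * normc (cint mu S (F l)) ^+ 2)).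
apply: (sum_sqr_cint_le mu mS (b := fst) (F := fun q => F q.2)
  (K := fun z w => riesz_kernel n alpha (normc (1 - inner z w))) C0) => //.
move=> z w' Sz Sw; apply: le_trans (kerC N z w' Sz Sw).2; rewrite lee_fin.
apply: (le_trans (ler_norm _)); apply: (le_trans (le_Re_normc _)).
rewrite ceval_inner (rE _ (fun x l => x%:C%C * (monomial l z * ((monomial l w')^*)%C))).
have -> : \sum_(q <- r) q.1%:C%C * F q.2 z * ((F q.2 w')^*)%C =
    (c z * ((c w')^*)%C) *
    \sum_(q <- r) q.1%:C%C * (monomial q.2 z * ((monomial q.2 w')^*)%C).
  rewrite mulr_sumr; apply: eq_bigr => q _; rewrite /F conjM; ring.
rewrite normcM ler_piMl ?normc_ge0 // normcM normc_conj.
by rewrite mulr_ile1 ?normc_ge0.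
Qed.

End Embedding.

(** * Passage to the limit *)
Section Limits.
Context d (T : measurableType d) (R : realType).
Context (mu : probability T R) (D : set T) (mD : measurable D).
Implicit Types (g : nat -> T -> R[i]).

Lemma cmeasurable_cvg g (l : T -> R[i]) : (forall m, cmeasurable D (g m)) ->
  (forall x, D x -> g m x @[m --> \oo] --> l x) -> cmeasurable D l.
Proof.
move=> mg gl; split.
  apply: (measurable_fun_cvg (h := fun m x => complex.Re (g m x))) => [m|x Dx].
    by case: (mg m).
  by apply: (cvg_comp _ _ (gl x Dx)); exact: continuous_Re.
apply: (measurable_fun_cvg (h := fun m x => complex.Im (g m x))) => [m|x Dx].
  by case: (mg m).
by apply: (cvg_comp _ _ (gl x Dx)); exact: continuous_Im.
Qed.

Lemma limn_einf_le (u : nat -> \bar R) B : (forall m, u m <= B)%E -> (limn_einf u <= B)%E.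
Proof.
move=> uB; rewrite limn_einf_lim; apply: lime_le; first exact: is_cvg_einfs.
apply: nearW => m; apply: le_trans (uB m).
by apply: ereal_inf_lbound; exists m => /=.
Qed.

Lemma fatou_normc g (l : T -> R[i]) (B : \bar R) :
  (forall m, cmeasurable D (g m)) -> cmeasurable D l ->
  {ae mu, forall x, D x -> g m x @[m --> \oo] --> l x} ->
  (forall m, \int[mu]_(x in D) (normc (g m x))%:E <= B)%E ->
  (\int[mu]_(x in D) (normc (l x))%:E <= B)%E.
Proof.
move=> mg ml gl gB.
have mn m : measurable_fun D (fun x => (normc (g m x))%:E).
  by apply/measurable_EFinP; exact: measurable_normc.
apply: (@le_trans _ _ (\int[mu]_(x in D) limn_einf (fun m => (normc (g m x))%:E))%E).
  rewrite le_eqVlt; apply/orP; left; apply/eqP.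
  apply: ae_eq_integral => //.
  - by apply/measurable_EFinP; exact: measurable_normc.
  - rewrite /limn_einf; apply: measurableT_comp => //.
    by apply: measurable_fun_limn_esup => m; exact: measurableT_comp.
  apply: filterS gl => x gl Dx; apply/esym.
  apply: (cvg_limn_einf_sup _).1; apply: cvg_EFin; first exact: nearW.
  by apply: (cvg_comp _ _ (gl Dx)); exact: continuous_normc.
apply: (le_trans (fatou mu mD mn _)); last exact: limn_einf_le.
by move=> m x _; rewrite lee_fin normc_ge0.
Qed.

End Limits.

(** * Unordered sums *)
Section Summation.
Context {R : realType}.

#[global] Instance totally_filter (I : choiceType) : ProperFilter (@totally I).
Proof.
apply: filter_from_proper; last by move=> A _; exists A => /=.
apply: filter_from_filter; first by exists fset0.
move=> A B _ _; exists (A `|` B)%fset => // C /= ABC; split => /=.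
  exact: fsubset_trans (fsubsetUl _ _) ABC.
exact: fsubset_trans (fsubsetUr _ _) ABC.
Qed.

(** Fatou's lemma wants sequences, while expansions converge along a net of
    finite sets; this sequence of finite sets is cofinal in the net. *)
Definition exhaustion (I : countType) (M : nat) : {fset I} :=
  [fset k | k in pmap choice.unpickle (iota 0 M)]%fset.

Lemma exhaustion_totally (I : countType) :
  exhaustion I M @[M --> \oo] --> @totally I.
Proof.
move=> P [A _ AP]; exists (\max_(k <- A) choice.pickle k).+1 => // M /= AM.
apply: AP => /=; apply/fsubsetP => k kA.
rewrite /exhaustion in_fset_ mem_pmap; apply/mapP.
exists (choice.pickle k); last by rewrite choice.pickleK.
rewrite mem_iota add0n /=; apply: leq_trans AM; rewrite ltnS.
exact: leq_bigmax_seq.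
Qed.

Lemma sums_to_cvg (I : countType) (u : I -> R[i]) l : sums_to u l ->
  \sum_(i <- exhaustion I M) u i @[M --> \oo] --> l.
Proof. by move=> ul; exact: (cvg_comp _ _ (@exhaustion_totally I) ul). Qed.

Lemma sums_toZ (I : choiceType) (u : I -> R[i]) (c l : R[i]) : sums_to u l ->
  sums_to (fun i => c * u i) (c * l).
Proof.
move=> ul; rewrite /sums_to; under eq_fun do rewrite -mulr_sumr.
exact: cvgMr.
Qed.

Lemma sums_toD (I : choiceType) (u v : I -> R[i]) (l m : R[i]) :
  sums_to u l -> sums_to v m -> sums_to (fun i => u i + v i) (l + m).
Proof.
move=> ul vm; rewrite /sums_to; under eq_fun do rewrite big_split /=.
exact: cvgD.
Qed.

Lemma sums_to_single (I : choiceType) (u : I -> R[i]) i0 :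
  (forall i, i != i0 -> u i = 0) -> sums_to u (u i0).
Proof.
move=> u0; apply: cvg_near_cst; exists [fset i0]%fset => // J /= iJ.
have {}iJ : i0 \in J by apply: (fsubsetP iJ); rewrite inE.
rewrite (bigD1_seq i0) //= big1 ?addr0 // => i ii0; exact: u0.
Qed.

End Summation.

(** * Algebra of power series expansions *)
Section Expansions.
Context {R : realType} {n : nat}.
Implicit Types (f g : 'rV[R[i]]_n -> R[i]) (a b : multiindex n -> R[i]) (k l : multiindex n).

Lemma eq_has_expansion f g a : f =1 g -> has_expansion f a -> has_expansion g a.
Proof. by move=> fg fa z z1; rewrite -fg; exact: fa. Qed.

Lemma has_expansionZ f a c : has_expansion f a ->
  has_expansion (fun z => c * f z) (fun k => c * a k).
Proof.
by move=> fa z z1; under eq_fun do rewrite -mulrA; exact: sums_toZ (fa z z1).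
Qed.

Lemma has_expansionD f g a b : has_expansion f a -> has_expansion g b ->
  has_expansion (fun z => f z + g z) (fun k => a k + b k).
Proof.
move=> fa gb z z1; under eq_fun do rewrite mulrDl.
exact: sums_toD (fa z z1) (gb z z1).
Qed.

Definition multi0 : multiindex n := [ffun=> 0%N].

Lemma monomial0 (z : 'rV[R[i]]_n) : monomial multi0 z = 1.
Proof. by rewrite /monomial big1 // => j _; rewrite ffunE expr0. Qed.

Lemma has_expansion_cst (c : R[i]) :
  has_expansion (fun=> c) (fun k => c * (k == multi0)%:R).
Proof.
move=> z z1; rewrite [X in sums_to _ X](_ : c = c * (multi0 == multi0)%:R * monomial multi0 z).
  by apply: sums_to_single => k /negbTE->; rewrite mulr0 mul0r.
by rewrite eqxx monomial0 !mulr1.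
Qed.

Definition madd k l : multiindex n := [ffun j => k j + l j]%N.
Definition msub k l : multiindex n := [ffun j => k j - l j]%N.

Lemma monomialD k l (z : 'rV[R[i]]_n) : monomial (madd k l) z = monomial k z * monomial l z.
Proof. by rewrite /monomial -big_split /=; apply: eq_bigr => j _; rewrite ffunE exprD. Qed.

Lemma maddK k : cancel (madd k) (fun l => msub l k).
Proof. by move=> l; apply/ffunP => j; rewrite !ffunE addnC addnK. Qed.

(** The test says that l dominates k, subtraction being truncated. *)
Definition shift_coef k a : multiindex n -> R[i] :=
  fun l => if madd k (msub l k) == l then a (msub l k) else 0.

(** A finite partial sum of the shifted series is z^k times a partial sum of
    the original one, over the set pulled back by l |-> l + k; pulling back is
    cofinal, so the limit is inherited. *)
Lemma has_expansion_monomialM f a k : has_expansion f a ->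
  has_expansion (fun z => monomial k z * f z) (shift_coef k a).
Proof.
move=> fa z z1; have /sums_toZ H := fa z z1.
pose pull (J : {fset multiindex n}) : {fset multiindex n} :=
  [fset msub l k | l in [fset l in J | madd k (msub l k) == l]]%fset.
have pullT : pull J @[J --> totally] --> @totally (multiindex n).
  move=> P [A _ AP]; exists [fset madd k l | l in A]%fset => // J /= AJ.
  apply: AP; apply/fsubsetP => l lA; apply/imfsetP; exists (madd k l) => /=.
    by rewrite !inE maddK eqxx andbT; apply: (fsubsetP AJ); exact: in_imfset.
  by rewrite maddK.
suff E : (fun J : {fset multiindex n} => \sum_(l <- J) shift_coef k a l * monomial l z) =
    (fun J => \sum_(l <- pull J) monomial k z * (a l * monomial l z)).
  by rewrite /sums_to E; exact: (cvg_comp _ _ pullT (H (monomial k z))).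
apply/funext => J; rewrite /pull big_imfset /=; last first.
  move=> l l'; rewrite !inE /= => /andP[_ /eqP <-] /andP[_ /eqP <-].
  by rewrite !maddK => ->.
rewrite -big_fset_condE /= [RHS]big_mkcond; apply: eq_bigr => l _.
rewrite /shift_coef; case: eqP => [E|_]; last by rewrite mul0r.
have -> : monomial l z = monomial k z * monomial (msub l k) z by rewrite -monomialD E.
by rewrite mulrCA.
Qed.

End Expansions.

(** * Uniqueness of expansions *)
Section Uniqueness.
Context {R : realType}.

(** Unordered convergence is absolute: far out, every finite partial sum is
    small, in particular those over the terms whose real (or imaginary) part
    has a given sign. *)
Lemma sums_to_abs_bounded (I : choiceType) (u : I -> R[i]) l : sums_to u l ->
  exists2 M : R, 0 <= M & forall J : {fset I}, \sum_(i <- J) normc (u i) <= M.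
Proof.
move=> /cvg_normcP /(_ 1 ltr01) [A _ HA].
have K (J : {fset I}) (P : pred I) :
    normc (\sum_(i <- J | (i \notin A) && P i) u i) <= 2.
  rewrite big_fset_condE /=; set B := [fset _ | _ in _ & _]%fset.
  have AB : \sum_(i <- (A `|` B)%fset) u i = \sum_(i <- A) u i + \sum_(i <- B) u i.
    rewrite -big_cat; apply: perm_big; apply: uniq_perm; rewrite ?fset_uniq //.
      rewrite cat_uniq !fset_uniq andbT /=; apply/hasPn => i.
      by rewrite !inE /= => /and3P[].
    by move=> i; rewrite mem_cat inE.
  have -> : \sum_(i <- B) u i = (l - \sum_(i <- A) u i) - (l - \sum_(i <- (A `|` B)%fset) u i).
    by rewrite AB; ring.
  apply: (le_trans (normcD_le _ _)); rewrite normc_opp -[2]/(1 + 1).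
  apply: lerD; apply: ltW; first exact: (HA A (fsubset_refl A)).
  exact: (HA _ (fsubsetUl A B)).
have part (h : R[i] -> R) (J : {fset I}) :
    (forall x, `|h x| <= normc x) -> {morph h : x y / x + y} ->
    \sum_(i <- J | i \notin A) `|h (u i)| <= 4.
  move=> hn hD; have h0 : h 0 = 0.
    by apply/eqP; rewrite -normr_le0 -[X in _ <= X](normc0 R).
  have hs P : \sum_(i <- J | (i \notin A) && P i) h (u i) =
      h (\sum_(i <- J | (i \notin A) && P i) u i).
    by elim/big_rec2: _ => [|i x y _ ->]; rewrite ?h0 ?hD.
  rewrite (bigID (fun i => 0 <= h (u i))) /= (_ : 4 = 2 + 2); last by ring.
  apply: lerD.
    under eq_bigr => i /andP[_ h1] do rewrite ger0_norm //.
    by rewrite hs (le_trans (ler_norm _)) // (le_trans (hn _)).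
  under eq_bigr => i /andP[_ h1] do rewrite ltr0_norm ?ltNge //.
  by rewrite sumrN hs (le_trans (ler_norm _)) // normrN (le_trans (hn _)).
exists (\sum_(i <- A) normc (u i) + (4 + 4)).
  by rewrite addr_ge0 // sumr_ge0 // => i _; exact: normc_ge0.
move=> J; rewrite (bigID (mem A)) /=; apply: lerD.
  rewrite big_fset_condE [X in _ <= X](bigID (mem J)) /= [X in _ <= X + _]big_fset_condE /=.
  have -> : [fset i | i in A & i \in J]%fset = [fset i | i in J & i \in A]%fset.
    by apply/fsetP => i; rewrite !inE /= andbC.
  by rewrite lerDl sumr_ge0 // => i _; exact: normc_ge0.
apply: (@le_trans _ _ (\sum_(i <- J | i \notin A) (`|complex.Re (u i)| + `|complex.Im (u i)|))).
  apply: ler_sum => i _; case: (u i) => a b; rewrite /normc /=.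
  rewrite -[X in _ <= X]ger0_norm ?addr_ge0 // -sqrtr_sqr ler_wsqrtr //.
  rewrite -(real_normK (num_real a)) -(real_normK (num_real b)) sqrrD.
  by rewrite addrAC lerDl mulrn_wge0 // mulr_ge0.
rewrite big_split; apply: lerD; apply: part.
- exact: le_Re_normc.
- exact: ReD.
- exact: le_Im_normc.
- exact: ImD.
Qed.

Lemma digits_inj B n (x y : 'I_n -> nat) :
  (forall j, x j < B)%N -> (forall j, y j < B)%N ->
  (\sum_(j < n) x j * B ^ j = \sum_(j < n) y j * B ^ j)%N -> x =1 y.
Proof.
elim: n x y => [|n IH] x y xB yB; first by move=> _ [].
rewrite !big_ord_recl /= expn0 !muln1.
have tail (z : 'I_n.+1 -> nat) :
    (\sum_(i < n) z (lift ord0 i) * B ^ bump 0 i)%N =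
    (B * \sum_(i < n) z (lift ord0 i) * B ^ i)%N.
  by rewrite big_distrr; apply: eq_bigr => i _; rewrite /bump add1n expnS mulnCA.
rewrite !tail => E.
have B0 : (0 < B)%N := leq_ltn_trans (leq0n _) (xB ord0).
have E0 : x ord0 = y ord0.
  have := congr1 (modn^~ B) E.
  by rewrite ![(B * _)%N]mulnC ![(_ + _ * B)%N]addnC !modnMDl !modn_small.
have {}E : x \o lift ord0 =1 y \o lift ord0.
  apply: IH => [j|j|]; [exact: xB|exact: yB|].
  by move/eqP: E; rewrite E0 eqn_add2l eqn_pmul2l // => /eqP.
by move=> j; case: (unliftP ord0 j) => [i ->|->] //; exact: E.
Qed.

Context {n : nat}.
Implicit Types (k l : multiindex n).

(** Kronecker's substitution: reading the entries of k as digits in base m + 1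
    separates the multi-indices of degree at most m. *)
Definition kron (m : nat) k : nat := (\sum_j k j * m.+1 ^ j)%N.

Lemma le_mdeg k j : (k j <= mdeg k)%N.
Proof. by rewrite /mdeg (bigD1 j) //= leq_addr. Qed.

Lemma kron_inj k l : mdeg k = mdeg l -> kron (mdeg k) k = kron (mdeg k) l -> k = l.
Proof.
move=> kl E; apply/ffunP; apply: (digits_inj (B := (mdeg k).+1)) => // j.
  by rewrite ltnS le_mdeg.
by rewrite ltnS kl le_mdeg.
Qed.

Lemma kron_le m k : (kron m k <= mdeg k * m.+1 ^ n)%N.
Proof.
rewrite /kron /mdeg big_distrl; apply: leq_sum => j _.
by rewrite leq_mul2l (leq_pexp2l (ltn0Sn m) (ltnW (ltn_ord j))) orbT.
Qed.

Definition wdeg (w : 'I_n -> nat) k : nat := (\sum_j w j * k j)%N.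

(** Along the curve z_j = t^(w_j) the term of index k is of order t^(e k), e
    being the weighted degree.  If the term k0 is the strictly lowest one, then
    dividing by t^(e k0) and letting t tend to 0 isolates its coefficient;
    absolute convergence at one point of the curve controls all the others. *)
Lemma lowest_coef_eq0 (a : multiindex n -> R[i]) (w : 'I_n -> nat) k0 :
  (forall j, 0 < w j)%N ->
  (forall k, k != k0 -> a k != 0 -> (wdeg w k0 < wdeg w k)%N) ->
  has_expansion (fun=> 0) a -> a k0 = 0.
Proof.
move=> w0 low ha.
(* n coordinates of modulus at most t0 form a point of the ball *)
pose t0 : R := n.+1%:R^-1.
have t00 : 0 < t0 by rewrite invr_gt0.
have t01 : t0 <= 1 by rewrite invf_le1 ?ler1n.
pose z (s : R) : 'rV[R[i]]_n := \row_j (((t0 * s) ^+ w j)%:C)%C.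
have zball s : 0 <= s <= 1 -> ball1 R n (z s).
  move=> /andP[s0 s1]; rewrite /ball1 /= /sqnorm.
  have ts0 : 0 <= t0 * s by rewrite mulr_ge0 // ltW.
  have tst : t0 * s <= t0 by rewrite ler_piMr // ltW.
  apply: (@le_lt_trans _ _ (\sum_(j < n) t0)).
    apply: ler_sum => j _; rewrite mxE normc_real ger0_norm ?exprn_ge0 //.
    rewrite -exprM; apply: le_trans tst; rewrite -[X in _ <= X]expr1.
    by apply: ler_wiXn2l; rewrite ?muln_gt0 ?w0 //; apply: le_trans t01; rewrite ler_piMr // ltW.
  by rewrite sumr_const card_ord -mulr_natl ltr_pdivrMr // mul1r ltr_nat.
have zmon s k : monomial k (z s) = (((t0 * s) ^+ wdeg w k)%:C)%C.
  rewrite /monomial /wdeg.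
  rewrite (eq_bigr (fun j => (((t0 * s) ^+ (w j * k j))%:C)%C)) => [|j _]; last first.
    by rewrite mxE -rmorphXn exprM.
  by rewrite -rmorph_prod prodrXr.
have nmon s k : 0 <= s -> normc (monomial k (z s)) = (t0 * s) ^+ wdeg w k.
  by move=> s0; rewrite zmon normc_real ger0_norm // exprn_ge0 // mulr_ge0 // ltW.
have z1ball : ball1 R n (z 1) by apply: zball; rewrite ler01 lexx.
have [M M0 HM] := sums_to_abs_bounded (ha _ z1ball).
set e0 := wdeg w k0 in low.
have key s : 0 < s <= 1 -> normc (a k0) * t0 ^+ e0 <= s * M.
  move=> /andP[s0 s1].
  rewrite -(ler_pM2r (exprn_gt0 e0 s0)) -mulrA -exprMn [s * M]mulrC -mulrA -exprS.
  apply/ler_addgt0Pr => e e_gt0.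
  have zsball : ball1 R n (z s) by apply: zball; rewrite (ltW s0).
  have /cvg_normcP /(_ e e_gt0) [A _ HA] := ha _ zsball.
  set J := (k0 |` A)%fset; have kJ : k0 \in J by rewrite !inE eqxx.
  have := HA J (fsubsetU1 _ _); rewrite /= sub0r normc_opp => HJ.
  have -> : normc (a k0) * (t0 * s) ^+ e0 = normc (a k0 * monomial k0 (z s)).
    by rewrite normcM nmon // ltW.
  have -> : a k0 * monomial k0 (z s) = \sum_(k <- J) a k * monomial k (z s) -
     \sum_(k <- J | k != k0) a k * monomial k (z s).
    by rewrite (bigD1_seq k0 kJ (fset_uniq J)) addrK.
  rewrite (le_trans (normcD_le _ _)) // addrC normc_opp lerD ?(ltW HJ) //.
  apply: (le_trans (normc_sum_le _ _ _)).
  apply: (@le_trans _ _ (\sum_(k <- J | k != k0) normc (a k * monomial k (z 1)) * s ^+ e0.+1)).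
    apply: ler_sum => k kk0; rewrite !normcM !nmon ?(ltW s0) // mulr1 -mulrA.
    have [->|ak] := eqVneq (a k) 0; first by rewrite normc0 !mul0r.
    rewrite exprMn ler_wpM2l ?normc_ge0 // ler_wpM2l ?exprn_ge0 ?(ltW t00) //.
    by apply: ler_wiXn2l; rewrite ?(ltW s0) //; exact: low.
  rewrite -mulr_suml ler_wpM2r ?exprn_ge0 ?(ltW s0) //.
  apply: le_trans (HM J); rewrite [X in _ <= X](bigD1_seq k0 kJ (fset_uniq J)) lerDr.
  exact: normc_ge0.
apply: eq0_normc; apply/eqP; apply: contraT => ak0.
have c0 : 0 < normc (a k0) * t0 ^+ e0.
  by rewrite mulr_gt0 ?exprn_gt0 // lt_def ak0 normc_ge0.
set c := normc (a k0) * _ in key c0.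
have cM : 0 < c + M by rewrite ltr_wpDr.
(* at s = c / (c + M) the bound c <= s M fails *)
have := key (c / (c + M)); rewrite divr_gt0 // ler_pdivrMr // mul1r lerDl M0 => /(_ isT).
rewrite mulrAC ler_pdivlMr // ler_pM2l // gerDr => c00.
by have := lt_le_trans c0 c00; rewrite ltxx.
Qed.

(** Induction on the degree m, then on the Kronecker code among the
    multi-indices of degree m.  The weights W + (m + 1)^j, with W large, order
    multi-indices by degree first and by code next, so the coefficient under
    study is the lowest one that may not vanish. *)
Lemma zero_expansion (a : multiindex n -> R[i]) :
  has_expansion (fun=> 0) a -> forall k, a k = 0.
Proof.
move=> ha k; have [m km] := ubnPeq (mdeg k); move/eqP: km.
elim/ltn_ind: m k => m IHm k.
have [e ke] := ubnPeq (kron m k); move/eqP: ke.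
elim/ltn_ind: e k => e IHe k ke km.
(* exceeds every Kronecker code in degree m *)
pose W := (m * m.+1 ^ n).+1.
have wE l : wdeg (fun j => W + m.+1 ^ j)%N l = (W * mdeg l + kron m l)%N.
  rewrite /wdeg /mdeg /kron big_distrr -big_split /=.
  by apply: eq_bigr => j _; rewrite mulnDl [(_ ^ _ * _)%N]mulnC.
apply: (lowest_coef_eq0 (w := fun j => W + m.+1 ^ j)%N) ha => // l lk al.
rewrite !wE km; have [lm|ml|lm] := ltngtP (mdeg l) m.
- by rewrite (IHm _ lm) ?eqxx // in al.
- apply: (@leq_trans (W * m.+1)%N); last first.
    by rewrite (leq_trans _ (leq_addr _ _)) // leq_mul2l ml orbT.
  by rewrite mulnSr ltn_add2l ltnS -[X in (_ <= X * _)%N]km kron_le.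
rewrite lm ltn_add2l ltnNge; apply/negP => kl.
move: kl; rewrite leq_eqVlt => /orP[/eqP kl|kl].
  by move/eqP: lk; apply; apply: kron_inj; rewrite lm ?km.
move: al; rewrite (IHe (kron m l)) ?eqxx //; by rewrite -ke.
Qed.

Lemma expansion_unique (f : 'rV[R[i]]_n -> R[i]) a b :
  has_expansion f a -> has_expansion f b -> a = b.
Proof.
move=> fa fb; apply/funext => k; apply/eqP; rewrite -subr_eq0 -mulN1r; apply/eqP.
apply: (zero_expansion (a := fun k => a k + -1 * b k)).
apply: eq_has_expansion (has_expansionD fa (has_expansionZ (c := -1) fb)) => z.
by rewrite mulN1r subrr.
Qed.

End Uniqueness.

(** * Noncyclicity *)
Section Cyclicity.
Context {R : realType} {n : nat}.
Implicit Types (f g p : 'rV[R[i]]_n -> R[i]) (alpha : R).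

Lemma has_expansion_taylor f : (exists a, has_expansion f a) -> has_expansion f (taylor f).
Proof. exact: xgetPex. Qed.

Lemma has_expansion_sum (I : Type) (r : seq I) (c : I -> R[i])
    (g : I -> 'rV[R[i]]_n -> R[i]) : (forall i, exists a, has_expansion (g i) a) ->
  exists a, has_expansion (fun z => \sum_(i <- r) c i * g i z) a.
Proof.
move=> ge; elim: r => [|i r [b IH]].
  eexists; apply: eq_has_expansion (@has_expansion_cst R n 0) => z.
  by rewrite big_nil.
have [a ha] := ge i; eexists.
apply: eq_has_expansion (has_expansionD (has_expansionZ (c := c i) ha) IH) => z.
by rewrite big_cons.
Qed.

Lemma lin_span_expansion f p : (exists a, has_expansion f a) ->
  lin_span (monomial_multiples f) p -> exists a, has_expansion p a.
Proof.
move=> [a fa] [m [c [g [gf ->]]]]; apply: has_expansion_sum => i.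
by have [k ->] := gf i; exists (shift_coef k a); exact: has_expansion_monomialM.
Qed.

Lemma sum_weight_le_dsqnorm alpha f (J : {fset multiindex n}) : (0 < n)%N ->
  ((\sum_(k <- J) weight alpha k * normc (taylor f k) ^+ 2)%:E <= dsqnorm alpha f)%E.
Proof.
move=> n0; apply: esum_ge; exists [set` J]; first by split => //; exact: finite_fset.
by rewrite -fsbig_seq ?fset_uniq // sumEFin.
Qed.

(** The norm is computed from some expansion of the constant 1; uniqueness
    identifies it with the obvious one. *)
Lemma cst1_dirichlet alpha : (0 < n)%N -> dirichlet alpha ((fun=> 1) : 'rV[R[i]]_n -> R[i]).
Proof.
move=> n0; have h1 := @has_expansion_cst R n 1; split.
- by move=> z _; exact: differentiable_cst.
- by eexists; exact: h1.
have -> : dsqnorm alpha ((fun=> 1) : 'rV[R[i]]_n -> R[i]) = \esum_(k in [set multi0])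
    (weight alpha k * normc (taylor ((fun=> 1) : 'rV[R[i]]_n -> R[i]) k) ^+ 2)%:E.
  rewrite [RHS]esum_mkcond; apply: eq_esum => k _; case: ifPn => // k0.
  rewrite (expansion_unique (has_expansion_taylor (ex_intro _ _ h1)) h1).
  have {}k0 : k != multi0 by apply: contra k0 => /eqP ->; rewrite inE.
  by rewrite (negbTE k0) mulr0 normc0 expr0n mulr0.
by rewrite esum_set1 ?ltry // lee_fin mulr_ge0 ?sqr_ge0 // ltW // weight_gt0.
Qed.

Lemma sqnormZ (r : R) (z : 'rV[R[i]]_n) : sqnorm (r%:C%C *: z) = r ^+ 2 * sqnorm z.
Proof.
rewrite /sqnorm mulr_sumr; apply: eq_bigr => j _.
by rewrite mxE normcM normc_real exprMn real_normK ?num_real.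
Qed.

Lemma monomialZ (r : R) k (z : 'rV[R[i]]_n) :
  monomial k (r%:C%C *: z) = (r ^+ mdeg k)%:C%C * monomial k z.
Proof.
rewrite /monomial (eq_bigr (fun j => (r ^+ k j)%:C%C * z 0 j ^+ k j)) => [|j _].
  by rewrite big_split /= -rmorph_prod prodrXr.
by rewrite mxE exprMn rmorphXn.
Qed.

(** Dilating by r multiplies the coefficient of index k by r^|k| <= 1, so the
    partial sums of g(r .) obey the bound for polynomials, uniformly in r. *)
Lemma radial_embedding alpha (mu : probability (borelCn R n) R) :
  0 < alpha <= n%:R -> (energy alpha mu < +oo)%E ->
  exists2 B : R, 0 <= B & forall g (s r : R), 0 <= r < 1 ->
    (exists a, has_expansion g a) -> (dsqnorm alpha g <= s%:E)%E ->
    cmeasurable (sphere1 R n : set (borelCn R n)) (fun z : borelCn R n => g (r%:C%C *: z)) /\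
    (\int[mu]_(z in sphere1 R n) (normc (g (r%:C%C *: z)))%:E <= (Num.sqrt (B * s))%:E)%E.
Proof.
move=> ha fe; have /andP[a0 an] := ha.
have n0 : (0 < n)%N by move: (lt_le_trans a0 an); rewrite ltr0n.
have [B B0 HB] := dirichlet_embedding ha fe; exists B => // g s r /andP[r0 r1] ge gs.
have hg := has_expansion_taylor ge; set a := taylor g in hg.
set S := sphere1 R n : set (borelCn R n).
have mS : measurable S := measurable_sphere1.
pose b k := a k * (r ^+ mdeg k)%:C%C.
pose P (M : nat) (z : borelCn R n) := \sum_(k <- exhaustion (multiindex n) M) b k * monomial k z.
have mP M : cmeasurable S (P M).
  apply: cmeasurable_sum => k; apply: cmeasurableM; first exact: cmeasurable_cst.
  exact: cmeasurable_monomial.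
have cvP z : S z -> P M z @[M --> \oo] --> g (r%:C%C *: z).
  move=> Sz; have rz : ball1 R n (r%:C%C *: z).
    by rewrite /ball1 /= sqnormZ Sz mulr1 exprn_ilt1.
  have := sums_to_cvg (hg _ rz); under eq_fun do under eq_bigr do rewrite monomialZ mulrA.
  exact.
have mg := cmeasurable_cvg mP cvP; split=> //.
apply: (fatou_normc mS mP mg); first by apply: aeW => z; exact: cvP.
move=> M; apply: le_trans (HB _ _) _; rewrite lee_fin ler_wsqrtr // ler_wpM2l //.
rewrite -lee_fin; apply: le_trans gs; apply: le_trans (sum_weight_le_dsqnorm alpha g _ n0).
rewrite lee_fin; apply: ler_sum => k _; rewrite ler_wpM2l ?(ltW (weight_gt0 _ _ n0)) //.
rewrite lerXn2r ?nnegrE ?normc_ge0 // normcM normc_real ler_piMr ?normc_ge0 //.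
by rewrite ger0_norm ?exprn_ge0 // exprn_ile1 // ltW.
Qed.

Lemma riesz_cap_gt0 alpha (E : set 'rV[R[i]]_n) : (0 < riesz_cap alpha E)%E ->
  exists2 mu : probability (borelCn R n) R, supported_on mu E & (energy alpha mu < +oo)%E.
Proof.
rewrite /riesz_cap => cap0.
have : (ereal_inf [set energy alpha mu | mu in [set mu | supported_on mu E]] < +oo)%E.
  by rewrite ltey; apply: contraTneq cap0 => ->; rewrite invey ltxx.
by move=> /ereal_inf_lt[_ [mu muE <-]]; exists mu.
Qed.

Definition radius (m : nat) : R := 1 - m.+2%:R^-1.

Lemma radius_itv m : 0 <= radius m < 1.
Proof. by rewrite /radius subr_ge0 invf_le1 ?ler1n ?ltr0n // gtrBl invr_gt0 ltr0n. Qed.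

Lemma radius_cvg : radius m @[m --> \oo] --> 1^'-.
Proof.
move=> P [e /= e0 HP]; suff : \forall m \near \oo, P (radius m) by [].
near=> m; apply: HP; last by case/andP: (radius_itv m).
rewrite /ball_ /= opprB addrC subrK ger0_norm ?invr_ge0 //.
apply: (@le_lt_trans _ _ m.+1%:R^-1).
  by rewrite lef_pV2 ?posrE ?ltr0n // ler_nat.
by near: m; exact: (near_infty_natSinv_lt (PosNum e0)).
Unshelve. all: by end_near. Qed.

(** Monomials are bounded by 1 on the closed ball, so every polynomial
    multiple of f inherits its radial zeros. *)
Lemma lin_span_radial_cvg0 f p (z : 'rV[R[i]]_n) :
  lin_span (monomial_multiples f) p -> boundary_zeros f z ->
  p ((radius m)%:C%C *: z) @[m --> \oo] --> (0 : R[i]).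
Proof.
move=> [q [c [g [gf ->]]]] [z1 fz].
have fz0 : f ((radius m)%:C%C *: z) @[m --> \oo] --> (0 : R[i]).
  exact: (cvg_comp _ _ radius_cvg fz).
apply/cvg_normcP => e e0; pose K := \sum_(i < q) normc (c i).
have K0 : 0 <= K by apply: sumr_ge0 => i _; exact: normc_ge0.
have K1 : 0 < K + 1 by rewrite ltr_wpDl.
have /cvg_normcP /(_ (e / (K + 1)) (divr_gt0 e0 K1)) := fz0.
apply: filterS => m; rewrite !sub0r !normc_opp ltr_pdivlMr // => fm.
apply: le_lt_trans fm; apply: (le_trans (normc_sum_le _ _ _)).
rewrite mulrDr mulr1; apply: ler_wpDr; first exact: normc_ge0.
rewrite mulrC mulr_suml; apply: ler_sum => i _.
have [k ->] := gf i; rewrite !normcM ler_wpM2l ?normc_ge0 // ler_piMl ?normc_ge0 //.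
apply: normc_monomial_le1; have /andP[r0 r1] := radius_itv m.
by rewrite sqnormZ z1 mulr1 exprn_ile1 // ltW.
Qed.

End Cyclicity.

Theorem theorem16 (R : realType) (n : nat) (alpha : R)
    (halpha : 0 < alpha <= n%:R)
    (f : 'rV[R[i]]_n -> R[i]) (hf : dirichlet alpha f)
    (hcap : (0 < riesz_cap alpha (boundary_zeros f))%E) :
  ~ cyclic alpha f.
Proof.
move=> cyc; have /andP[a0 an] := halpha.
have n0 : (0 < n)%N by move: (lt_le_trans a0 an); rewrite ltr0n.
have [mu muZ fe] := riesz_cap_gt0 hcap.
have [B B0 HB] := radial_embedding halpha fe.
have [_ fa _] := hf.
set S := sphere1 R n : set (borelCn R n).
have mS : measurable S := measurable_sphere1.
(* any eps with B eps^2 < 1 would do *)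
have e0 : 0 < (B + 1)^-1 by rewrite invr_gt0 ltr_wpDl.
have : dclosure alpha (lin_span (monomial_multiples f)) (fun=> 1).
  by rewrite cyc; exact: cst1_dirichlet.
move=> [_ /(_ _ e0)[p pspan /ltW p_close]].
have hp := lin_span_expansion fa pspan.
pose g (z : 'rV[R[i]]_n) : R[i] := 1 - p z.
have ge : exists a, has_expansion g a.
  have [a pa] := hp; eexists.
  apply: eq_has_expansion (has_expansionD (@has_expansion_cst R n 1)
    (has_expansionZ (c := -1) pa)) => z.
  by rewrite mulN1r.
have Hg m := HB g _ _ (radius_itv m) ge p_close.
have mg m := (Hg m).1; have {Hg} ig m := (Hg m).2.
have mS1 : mu S = 1%E.
  have : mu (~` S) = 0%E.
    apply: measure_negligible; first exact: measurableC.
    by apply: negligibleS muZ => z; apply: contra_not => -[].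
  by rewrite probability_setC // => /eqP; rewrite sube_eq // add0e => /eqP.
have : (\int[mu]_(z in S) (normc (1 : R[i]))%:E <=
        (Num.sqrt (B * (B + 1)^-1 ^+ 2))%:E)%E.
  apply: (fatou_normc mS mg (@cmeasurable_cst _ _ _ S 1) _ ig).
  apply: negligibleS muZ => z /= H Zz; apply: H => _ /=.
  have := lin_span_radial_cvg0 pspan Zz => /cvg_normcP H; apply/cvg_normcP => e /H.
  by apply: filterS => m; rewrite /g subKr sub0r normc_opp.
rewrite normc1 (integral_cst mu mS) [X in (1 * X)%E](_ : _ = 1%E); last exact: mS1.
rewrite mul1e lee_fin leNgt => /negP; apply.
have B1 : 0 < B + 1 by rewrite ltr_wpDl.
rewrite -[X in _ < X]sqrtr1 ltr_sqrt // expr2 mulrA.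
rewrite ltr_pdivrMr // mul1r ltr_pdivrMr //; nra.
Qed.
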